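(* Let $H$ be a finite simple graph. If $H$ or its complement $\overline{H}$ contains a non-complete $3$-connected induced subgraph on at least five vertices, then $H$ has a finite deletion host.
   Context: All graphs are simple, undirected and finite. A $3$-connected graph has at least four vertices and remains connected after deletion of any set of at most two vertices. A finite deletion host for $H$ is a finite graph $G$ such that $E(G)\neq\varnothing$, $G$ contains no induced subgraph isomorphic to $H$, and for every $e\in E(G)$ the graph $G-e$ (edge deleted, vertices kept) contains an induced subgraph isomorphic to $H$. *)

(* Defs.v *)
From mathcomp Require Import all_boot.

Set Implicit Arguments.
Unset Strict Implicit.
Unset Printing Implicit Defensive.

Record sgraph := SGraph {
  vertex :> finType;
  adj : rel vertex;
  adj_sym : symmetric adj;
  adj_irrefl : irreflexive adj }.

Section Graphs.
Variable G : sgraph.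

Definition edges : {set {set G}} :=
  [set [set p.1; p.2] | p : G * G & adj p.1 p.2].

Section Induced.
Variable S : {set G}.

Definition induced_adj : rel {x : G | x \in S} :=
  fun x y => adj (val x) (val y).

Lemma induced_adj_sym : symmetric induced_adj.
Proof. by move=> x y; apply: adj_sym. Qed.

Lemma induced_adj_irrefl : irreflexive induced_adj.
Proof. by move=> x; apply: adj_irrefl. Qed.

Definition induced : sgraph := SGraph induced_adj_sym induced_adj_irrefl.
End Induced.

Section DeleteEdge.
Variable e : {set G}.

Definition del_edge_adj : rel G :=
  fun x y => adj x y && ([set x; y] != e).

Lemma del_edge_adj_sym : symmetric del_edge_adj.
Proof. by move=> x y; rewrite /del_edge_adj adj_sym setUC. Qed.

Lemma del_edge_adj_irrefl : irreflexive del_edge_adj.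
Proof. by move=> x; rewrite /del_edge_adj adj_irrefl. Qed.

Definition del_edge : sgraph := SGraph del_edge_adj_sym del_edge_adj_irrefl.
End DeleteEdge.

Definition compl_adj : rel G := fun x y => (x != y) && ~~ adj x y.

Lemma compl_adj_sym : symmetric compl_adj.
Proof. by move=> x y; rewrite /compl_adj adj_sym eq_sym. Qed.

Lemma compl_adj_irrefl : irreflexive compl_adj.
Proof. by move=> x; rewrite /compl_adj eqxx. Qed.

Definition compl : sgraph := SGraph compl_adj_sym compl_adj_irrefl.

Definition complete : Prop := forall x y : G, x != y -> adj x y.

(* The graph without vertices counts as connected here; this is immaterial in
   [three_connected], where at least two vertices survive every deletion. *)
Definition connected : Prop := forall x y : G, connect (@adj G) x y.
End Graphs.

Definition three_connected (G : sgraph) : Prop :=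
  4 <= #|G| /\
  forall X : {set G}, #|X| <= 2 -> connected (induced (~: X)).

Definition isomorphic (G K : sgraph) : Prop :=
  exists2 f : G -> K, bijective f & forall x y : G, adj (f x) (f y) = adj x y.

Definition contains_induced (G H : sgraph) : Prop :=
  exists S : {set G}, isomorphic (induced S) H.

(* Finiteness of the host is built into [sgraph]. *)
Definition deletion_host (H G : sgraph) : Prop :=
  [/\ edges G != set0,
      ~ contains_induced G H
    & forall e : {set G}, e \in edges G -> contains_induced (del_edge e) H].

Definition has_noncomplete_3connected_induced (H : sgraph) : Prop :=
  exists S : {set H},
    [/\ 5 <= #|induced S|, three_connected (induced S)
      & ~ complete (induced S)].

(* Main.v *)
Require Import Defs.
From mathcomp Require Import all_boot.
From mathcomp Require Import all_fingroup boolp zify.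

Set Implicit Arguments.
Unset Strict Implicit.
Unset Printing Implicit Defensive.

(* Let [W] be [H] or its complement and let [C] induce in [W] a non-complete
   3-connected graph, with [#|C|] maximal over both choices.  Pick two vertices
   [u], [v] of [C] that are not adjacent in [H], and let [P] be [H] with the edge
   [uv] added.  By maximality no copy of [W[C]] survives in [W] after switching
   the pair [uv]: a second copy could share with [C] only a cut of size at most
   two, and then the complement of [W] would contain a large join.

   The host is a finite union of copies of [P] in which every edge of a copy is
   also the [uv]-edge of some copy; deleting it creates an induced [H].  The
   copies are arranged like the nodes of a tree, consecutive ones sharing at
   most two vertices; all pairs outside the copies are non-edges if [W = H] and
   edges if [W] is the complement (in the latter case superfluous edges are
   removed greedily).  A 3-connected subgraph cannot cross a 2-vertex cut, so a
   copy of [W[C]] would lie inside a single copy of [P], which is impossible.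

   A finite arrangement that looks like a tree to all sets of [#|H|] vertices
   comes from a finite group in the manner of Otto's acyclic groups: vertices of
   the host are coloured cosets of subgroups [S i] generated by the letters at
   colour [i].  Short cyclic products of elements of the [S i] are detected by
   letting the group act on chains of Cayley graphs glued along cosets, where
   letters without an outgoing edge act as loops. *)

Lemma eq_set2 (T : finType) (x y z w : T) :
  ([set x; y] == [set z; w]) = ((x == z) && (y == w) || (x == w) && (y == z)).
Proof.
apply/eqP/orP => [E0|]; last first.
  by case=> /andP[/eqP-> /eqP->] //; rewrite setUC.
have := set21 x y; have := set22 x y; rewrite E0 !inE.
have := set21 z w; have := set22 z w; rewrite -E0 !inE.
rewrite ![w == _]eq_sym ![z == _]eq_sym.
by case: (x == z); case: (x == w); case: (y == z); case: (y == w) => //= *; auto.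
Qed.

(** * A maximal 3-connected core *)

Lemma connect_homo (U V : finType) (e : rel U) (e' : rel V) (f : U -> V) :
    (forall x y, e x y -> e' (f x) (f y)) ->
  forall x y, connect e x y -> connect e' (f x) (f y).
Proof.
move=> ef x y /connectP[p + ->]; elim: p x => [|z p IH] x /=.
  by rewrite connect0.
case/andP=> xz /IH; apply: connect_trans; apply: connect1; exact: ef.
Qed.

Definition within (V : finType) (r : rel V) (A : {set V}) : rel V :=
  fun x y => [&& r x y, x \in A & y \in A].

Definition set_conn3 (V : finType) (r : rel V) (C : {set V}) : bool :=
  (3 < #|C|) && [forall A : {set V}, (#|A| <= 2) ==>
    [forall x in C :\: A, forall y in C :\: A, connect (within r (C :\: A)) x y]].

Definition noncomplete_on (V : finType) (r : rel V) (C : {set V}) : bool :=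
  [exists x in C, exists y in C, (x != y) && ~~ r x y].

Lemma set_conn3P (V : finType) (r : rel V) (C : {set V}) :
  reflect (3 < #|C| /\ forall A : {set V}, #|A| <= 2 -> forall x y,
      x \in C :\: A -> y \in C :\: A -> connect (within r (C :\: A)) x y)
    (set_conn3 r C).
Proof.
apply: (iffP andP) => -[C4 H]; split=> //.
  move=> A A2 x y xC yC; move/forallP/(_ A)/implyP/(_ A2)/forall_inP: H.
  by move=> /(_ x xC)/forall_inP; apply.
apply/forallP=> A; apply/implyP=> A2; apply/forall_inP=> x xC.
by apply/forall_inP=> y yC; apply: H.
Qed.

Lemma within_sym (V : finType) (r : rel V) A :
  symmetric r -> connect_sym (within r A).
Proof.
move=> rs; apply: sym_connect_sym => x y; rewrite /within rs.
by congr (_ && _); apply: andbC.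
Qed.

(* Complementation ([b = true]) makes the deletion and the completion problem
   instances of the same construction. *)
Definition twist (V : eqType) (h : rel V) (b : bool) : rel V :=
  fun x y => (x != y) && (h x y (+) b).

Lemma twist_sym (V : eqType) (h : rel V) b : symmetric h -> symmetric (twist h b).
Proof. by move=> hs x y; rewrite /twist eq_sym hs. Qed.

Definition add_edge (V : eqType) (h : rel V) (u v : V) : rel V :=
  fun x y => h x y || ((x, y) \in [:: (u, v); (v, u)]).

Lemma leq_cardsD (V : finType) (C A : {set V}) : #|C| - #|A| <= #|C :\: A|.
Proof. by rewrite cardsD leq_sub2l // subset_leq_card // subsetIr. Qed.

Section Core.
Variables (V : finType) (h : rel V).
Hypothesis h_sym : symmetric h.

(** The flag belongs to the data because sizes are maximised over the graph and its complement
    together: [no_copy] produces a larger core in one of the two. *)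
Definition core (p : bool * {set V}) : bool :=
  [&& 4 < #|p.2|, set_conn3 (twist h p.1) p.2 & noncomplete_on (twist h p.1) p.2].

Lemma conn3_edge (r : rel V) (C A : {set V}) : set_conn3 r C -> 4 < #|C| ->
  #|A| <= 2 -> exists x y, [/\ x \in C :\: A, y \in C :\: A & r x y].
Proof.
case/set_conn3P=> _ rC C5 A2.
have : 1 < #|C :\: A|.
  by have := leq_cardsD C A; lia.
case/card_gt1P=> x [y [xC yC xy]].
have /connectP[[|z p] /= zP Ey] := rC A A2 x y xC yC.
  by rewrite Ey eqxx in xy.
by case/andP: zP => /and3P[xz _ zC] _; exists x, z.
Qed.


Lemma core_exists b0 C0 : core (b0, C0) ->
  exists b C u v, [/\ core (b, C), u \in C, v \in C, u != v & ~~ h u v] /\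
    forall C', core (~~ b, C') \/ core (b, C') -> #|C'| <= #|C|.
Proof.
move=> core0; pose f (p : bool * {set V}) := #|p.2|.
case: (@arg_maxnP _ (b0, C0) core f core0) => -[b C] /= bC max.
(* For [b = true] the pair is an edge of [twist h b], supplied by 3-connectivity; for [b = false] it
   is a missing edge, supplied by non-completeness. *)
have [u [v [uC vC uv huv]]] : exists u v, [/\ u \in C, v \in C, u != v & ~~ h u v].
  case/and3P: bC; clear max; case: b => /= C5 Cc Cn.
    have [||x [y [xC yC /andP[xy hxy]]]] := @conn3_edge _ _ set0 Cc.
    - by [].
    - by rewrite cards0.
    move: xC yC; rewrite !setD0 => xC yC.
    by exists x, y; rewrite xC yC xy -addbT.
  case/exists_inP: Cn => x xC /exists_inP[y yC /andP[xy]].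
  by rewrite /twist xy addbF => hxy; exists x, y.
exists b, C, u, v; split=> // C' [H|H]; exact: (max _ H).
Qed.

Section NoCopy.
Variables (b : bool) (C : {set V}) (u v : V).
Hypothesis bC : core (b, C).
Hypothesis uC : u \in C.
Hypothesis vC : v \in C.
Hypothesis uv : u != v.
Hypothesis huv : ~~ h u v.
Hypothesis max : forall C', core (~~ b, C') \/ core (b, C') -> #|C'| <= #|C|.

Local Notation r := (twist h b).
Local Notation r' := (twist h (~~ b)).
Local Notation t := (twist (add_edge h u v) b).

Let C5 : 4 < #|C|. Proof. by case/and3P: bC. Qed.
Let Cc : set_conn3 r C. Proof. by case/and3P: bC. Qed.
Let Cn : noncomplete_on r C. Proof. by case/and3P: bC. Qed.

Lemma twist_add x y : (x, y) \notin [:: (u, v); (v, u)] -> t x y = r x y.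
Proof. by rewrite /twist /add_edge => /negbTE ->; rewrite orbF. Qed.

Variable k : V -> V.
Hypothesis k_inj : {in C &, injective k}.
Hypothesis kE : {in C &, forall x y, t (k x) (k y) = r x y}.

Local Notation C' := (k @: C).

Let cardC' : #|C'| = #|C|. Proof. exact: card_in_imset. Qed.

(** By counting: a copy on [C] itself would give [r] and [t] equally many adjacent pairs there, yet
    they differ on [C] exactly in the pair [u], [v]. *)
Lemma copy_neq : C' != C.
Proof.
apply/eqP=> EC.
pose Er := [set p in setX C C | r p.1 p.2].
pose Et := [set p in setX C C | t p.1 p.2].
have cE : #|Er| = #|Et|.
  have -> : Et = [set (k p.1, k p.2) | p in Er].
    apply/setP=> -[x y]; apply/idP/imsetP.
      rewrite !inE /= => /andP[/andP[xC yC] txy].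
      move: xC yC; rewrite -{1 2}EC => /imsetP[x' x'C Ex] /imsetP[y' y'C Ey].
      exists (x', y'); rewrite ?Ex ?Ey // !inE /= x'C y'C /= -kE //.
      by rewrite -Ex -Ey.
    case=> -[x' y']; rewrite !inE /= => /andP[/andP[xC yC] rxy] [-> ->].
    by rewrite kE // rxy -EC !imset_f.
  rewrite card_in_imset // => -[x y] [x' y']; rewrite !inE /=.
  move=> /andP[/andP[xC yC] _] /andP[/andP[xC' yC'] _] [Ex Ey].
  by rewrite (k_inj xC xC' Ex) (k_inj yC yC' Ey).
have rt x y : t x y != r x y -> t x y = ~~ b.
  move=> txy; have : (x, y) \in [:: (u, v); (v, u)].
    by apply: contraR txy => /twist_add ->.
  move: txy; rewrite /twist /add_edge => _ H; rewrite H orbT /=.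
  have -> : x != y by move: H; rewrite !inE => /orP[] /eqP[-> ->] //; rewrite eq_sym.
  by case: b.
have tuv : t u v = ~~ b.
  by rewrite /twist /add_edge uv !inE eqxx orbT /=; case: b.
have ruv : r u v = b by rewrite /twist uv (negbTE huv) /=; case: b.
have uvC : (u, v) \in setX C C by rewrite inE /= uC.
have [bT|bF] := boolP b.
  have : Et \proper Er.
    apply/properP; split; last by exists (u, v); rewrite inE uvC /= ?ruv ?tuv ?bT.
    apply/subsetP=> -[x y]; rewrite !inE /= => /andP[-> txy] /=.
    by case rxy: (r x y) (rt x y) => //; rewrite txy => /(_ isT); rewrite bT.
  by move/proper_card; rewrite cE ltnn.
have : Er \proper Et.
  apply/properP; split; last by exists (u, v); rewrite inE uvC /= ?ruv ?tuv.
  apply/subsetP=> -[x y]; rewrite !inE /= => /andP[-> rxy] /=.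
  by case txy: (t x y) (rt x y) => //; rewrite rxy => /(_ isT); rewrite bF.
by move/proper_card; rewrite cE ltnn.
Qed.

Lemma no_copy : False.
Proof.
have rsym := twist_sym b h_sym.
set U := C :|: C'.
have UC : #|C| < #|U|.
  have : C \proper U.
    rewrite properE subsetUl /=; apply: contra copy_neq => UC.
    rewrite eqEcard cardC' leqnn andbT; apply: subset_trans UC.
    exact: subsetUr.
  exact: proper_card.
have Un : noncomplete_on r U.
  case/exists_inP: Cn => x xC /exists_inP[y yC rxy].
  apply/exists_inP; exists x; first by rewrite inE xC.
  by apply/exists_inP; exists y; rewrite // inE yC.
(* A 3-connected union would be a larger core for the same [b]. *)
have : ~~ set_conn3 r U.
  apply/negP => Uc; have := UC; rewrite ltnNge => /negP; apply.
  by apply: max; right; rewrite /core /= Uc Un (ltn_trans C5 UC).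
rewrite /set_conn3 (ltn_trans (ltnW C5) UC) /= negb_forall => /existsP[A].
rewrite negb_imply => /andP[A2]; rewrite negb_forall_in => /exists_inP[x xU].
rewrite negb_forall_in => /exists_inP[y yU xy].
have [_ CcA] := set_conn3P _ _ Cc.
have [c0 [c1 [c0C c1C rc01]]] := conn3_edge Cc C5 A2.
(* The component containing all of [C :\: A]. Since [A] separates [U], some vertex of [C'] lies
   outside it, and then so does all of [C' :\: A]. *)
pose K := [set z | connect (within r (U :\: A)) c0 z].
have CU : C :\: A \subset U :\: A by apply: setSD; apply: subsetUl.
have C'U : C' :\: A \subset U :\: A by apply: setSD; apply: subsetUr.
have CK : C :\: A \subset K.
  apply/subsetP=> z zC; rewrite inE.
  apply: (@connect_homo _ _ (within r (C :\: A)) _ id) (CcA A A2 c0 z c0C zC) => a c.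
  by case/and3P=> ac aC cC; apply/and3P; split=> //; apply: (subsetP CU).
have [z zU zK] : exists2 z, z \in U :\: A & z \notin K.
  have [xK|xK] := boolP (x \in K); last by exists x.
  exists y => //; apply: contra xy => yK; move: xK yK; rewrite !inE => xK.
  by apply: connect_trans; rewrite (within_sym _ rsym).
have zC' : z \in C' :\: A.
  move: zU; rewrite !inE => /andP[zA /orP[zC|zC]]; rewrite zA //.
  by case/negP: zK; apply: (subsetP CK); rewrite inE zA.
have C'c a c : a \in C' :\: A -> c \in C' :\: A ->
    connect (within t (C' :\: A)) a c.
  rewrite !inE => /andP[aA /imsetP[a' aC Ea]] /andP[cA /imsetP[c' cC Ec]].
  pose A' := [set w in C | k w \in A].
  have A'2 : #|A'| <= 2.
    apply: leq_trans A2; rewrite -(@card_in_imset _ _ k).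
      apply: subset_leq_card; apply/subsetP=> _ /imsetP[w wA' ->].
      by move: wA'; rewrite inE => /andP[].
    by move=> w w'; rewrite !inE => /andP[wC _] /andP[wC' _]; apply: k_inj.
  have inA' w : w \in C -> k w \notin A -> w \in C :\: A'.
    by move=> wC wA; rewrite !inE wC /= wA.
  rewrite Ea Ec; apply: (@connect_homo _ _ (within r (C :\: A')) _ k).
    move=> w w' /and3P[ww' wC wC'].
    have [wC1 wA1] : w \in C /\ k w \notin A.
      by move: wC; rewrite !inE => /andP[+ wC]; rewrite wC.
    have [wC2 wA2] : w' \in C /\ k w' \notin A.
      by move: wC'; rewrite !inE => /andP[+ wC3]; rewrite wC3.
    by apply/and3P; rewrite kE // !inE wA1 wA2 !imset_f.
  by apply: CcA => //; apply: inA'; rewrite // -?Ea -?Ec.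
(* [t] and [r] differ only at [u], [v], which lie in [C]; a step along the switched pair therefore
   also ends in [K]. *)
have Kstep a c : a \in K -> within t (C' :\: A) a c -> c \in K.
  move=> aK /and3P[tac aC' cC'].
  have [acuv|acuv] := boolP ((a, c) \in [:: (u, v); (v, u)]).
    have cC : c \in C by move: acuv; rewrite !inE => /orP[] /eqP[_ ->].
    by apply: (subsetP CK); move: cC'; rewrite !inE cC => /andP[->].
  rewrite twist_add // in tac.
  move: aK; rewrite !inE => aK; apply: connect_trans aK (connect1 _).
  by rewrite /within tac !(subsetP C'U).
have KC' a : a \in C' :\: A -> a \notin K.
  move=> aC'; apply: contra zK => aK.
  have /connectP[p pP ->] := C'c _ _ aC' zC'.
  by elim: p a aK pP {aC'} => //= c p IH a aK /andP[/(Kstep _ _ aK)/IH]; apply.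
have cross a c : a \in C :\: A -> c \in C' :\: A -> r' a c && r' c a.
  move=> aC cC'; have cK := KC' _ cC'; have aK := subsetP CK _ aC.
  rewrite (twist_sym (~~ b) h_sym c a) andbb.
  have ac : a != c by apply: contraNneq cK => <-.
  rewrite /twist ac addbN /=; apply: contra cK => hac.
  move: aK; rewrite !inE => aK; apply: connect_trans aK (connect1 _).
  by rewrite /within /twist ac hac (subsetP CU _ aC) (subsetP C'U _ cC').
have disj : [disjoint C :\: A & C' :\: A].
  apply/pred0P=> a; apply/negP => /andP[/= aC aC'].
  by case/negP: (KC' _ aC'); apply: (subsetP CK).
set J := (C :\: A) :|: (C' :\: A).
have cJ : #|J| = #|C :\: A| + #|C' :\: A|.
  by apply/eqP; rewrite (leq_card_setU _ _).2.
have card1 := leq_cardsD C A; have card2 := leq_cardsD C' A.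
(* Each side keeps at least [#|C| - 2] vertices, and twice that exceeds [#|C|] because [#|C|] is at
   least five. *)
have JC : #|C| < #|J|.
  by rewrite cJ; rewrite cardC' in card2; clear -C5 A2 card1 card2; lia.
(* Both sides of the join have at least three vertices, so both survive any deletion of two; the
   [r]-edge [c0 c1] becomes the missing edge. *)
suff : core (~~ b, J) by move=> cJ'; have := max (or_introl cJ'); rewrite leqNgt JC.
apply/and3P; split=> /=; first exact: ltn_trans JC.
  apply/set_conn3P; split; first by apply: ltn_trans JC; apply: ltnW.
  move=> A' A'2.
  have side (D : {set V}) : #|C| - #|A| <= #|D :\: A| ->
      exists2 d, d \in D :\: A & d \notin A'.
    move=> cD; have : 0 < #|D :\: A :\: A'|.
      by have := leq_cardsD (D :\: A) A'; clear -cD C5 A2 A'2; lia.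
    by case/card_gt0P=> d /setDP[dD dA]; exists d.
  have [d dC dA] := side C card1.
  have [d' dC' dA'] : exists2 d, d \in C' :\: A & d \notin A'.
    by apply: side; rewrite -cardC'.
  have W a c : a \in J :\: A' -> c \in J :\: A' -> r' a c ->
     connect (within r' (J :\: A')) a c.
    by move=> aJ cJ0 ac; apply: connect1; rewrite /within ac aJ cJ0.
  have dJ : d \in J :\: A' by rewrite inE dA inE dC.
  have dJ' : d' \in J :\: A' by rewrite inE dA' inE dC' orbT.
  have tod a : a \in J :\: A' -> connect (within r' (J :\: A')) d a.
    move=> aJ; have := aJ; rewrite inE => /andP[aA' /setUP[aC|aC']].
      apply: (connect_trans (W _ _ dJ dJ' _)); first by case/andP: (cross _ _ dC dC').
      by apply: W => //; case/andP: (cross _ _ aC dC').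
    by apply: W => //; case/andP: (cross _ _ dC aC').
  move=> a c aJ cJ0; apply: connect_trans (tod _ cJ0).
  rewrite (within_sym _ (twist_sym (~~ b) h_sym)); exact: tod.
apply/exists_inP; exists c0; first by rewrite inE c0C.
apply/exists_inP; exists c1; first by rewrite inE c1C.
move: rc01; rewrite /twist => /andP[-> ]; rewrite addbN /= => ->.
by [].
Qed.
End NoCopy.
End Core.

Import GroupScope.

(** * Words and universal permutation groups *)

Section Words.
Variable E : finType.

Definition ev (gT : finGroupType) (a : E -> gT) (w : seq E) : gT :=
  \prod_(e <- w) a e.

(** Expresses that [a e] to [b e] extends to a homomorphism on the subgroup generated by the letters
    in [A]. Positive words suffice because the groups are finite. *)
Definition factors (g1 g2 : finGroupType) (A : pred E) (a : E -> g1)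
    (b : E -> g2) : Prop :=
  forall w w', all A w -> all A w' -> ev a w = ev a w' -> ev b w = ev b w'.

Lemma ev_nil (gT : finGroupType) (a : E -> gT) : ev a [::] = 1.
Proof. exact: big_nil. Qed.

Lemma ev_cons (gT : finGroupType) (a : E -> gT) e w :
  ev a (e :: w) = a e * ev a w.
Proof. exact: big_cons. Qed.

Lemma ev_cat (gT : finGroupType) (a : E -> gT) w w' :
  ev a (w ++ w') = ev a w * ev a w'.
Proof. exact: big_cat. Qed.

Lemma ev_pair (g1 g2 : finGroupType) (a : E -> g1) (b : E -> g2) w :
  ev (fun e => (a e, b e) : (g1 * g2)%type) w = (ev a w, ev b w).
Proof. by elim: w => [|e w IH]; rewrite ?ev_nil // !ev_cons IH. Qed.

Lemma ev_in (gT : finGroupType) (a : E -> gT) (A : pred E) (w : seq E) :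
  all A w -> ev a w \in <<[set a e | e in A]>>.
Proof.
elim: w => [|e w IH] /=; first by rewrite ev_nil group1.
case/andP=> Ae /IH; rewrite ev_cons; apply: groupM.
by apply: mem_gen; apply: imset_f.
Qed.

Lemma genE (gT : finGroupType) (a : E -> gT) (A : pred E) g :
  g \in <<[set a e | e in A]>> -> exists2 w, all A w & g = ev a w.
Proof.
case/gen_prodgP=> n [c cA ->].
elim: n c cA => [|n IH] c cA.
  by exists [::]; rewrite // ev_nil big_ord0.
have [w Aw Ew] := IH (fun i => c (lift ord0 i)) (fun i => cA _).
have /imsetP[e Ae Ee] := cA ord0.
exists (e :: w); first by rewrite /= Aw andbT.
by rewrite ev_cons big_ord_recl Ee Ew.
Qed.

Lemma ev_permM (X : finType) (a : E -> {perm X}) e w x :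
  ev a (e :: w) x = ev a w (a e x).
Proof. by rewrite ev_cons permM. Qed.

Lemma ev_perm_cat (X : finType) (a : E -> {perm X}) w w' x :
  ev a (w ++ w') x = ev a w' (ev a w x).
Proof. by rewrite ev_cat permM. Qed.

Lemma ev_perm_nil (X : finType) (a : E -> {perm X}) x : ev a [::] x = x.
Proof. by rewrite ev_nil perm1. Qed.

End Words.

Section EmbedPerm.
Variables (X Z : finType) (f : X -> Z).
Hypothesis f_inj : injective f.

Definition embed_fun (s : {perm X}) (z : Z) : Z :=
  if [pick x | f x == z] is Some x then f (s x) else z.

Lemma embed_funE s x : embed_fun s (f x) = f (s x).
Proof.
rewrite /embed_fun; case: pickP => [y /eqP/f_inj -> //|/(_ x)].
by rewrite eqxx.
Qed.

Lemma embed_fun_out s z : z \notin codom f -> embed_fun s z = z.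
Proof.
move=> zNf; rewrite /embed_fun; case: pickP => // x /eqP fx.
by rewrite -fx codom_f in zNf.
Qed.

Lemma embed_fun_inj s : injective (embed_fun s).
Proof.
move=> y z; case: (boolP (y \in codom f)) => [/codomP[y' ->]|yN];
  case: (boolP (z \in codom f)) => [/codomP[z' ->]|zN];
  rewrite ?embed_funE ?embed_fun_out //.
- by move/f_inj/perm_inj ->.
- by move=> E; rewrite -E codom_f in zN.
- by move=> E; rewrite E codom_f in yN.
Qed.

Definition embed_perm s : {perm Z} := perm (@embed_fun_inj s).

Lemma embed_permE s x : embed_perm s (f x) = f (s x).
Proof. by rewrite permE embed_funE. Qed.

Lemma embed_perm_out s z : z \notin codom f -> embed_perm s z = z.
Proof. by rewrite permE; apply: embed_fun_out. Qed.

Lemma ev_embed (E : finType) (a : E -> {perm X}) w :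
  ev (fun e => embed_perm (a e)) w = embed_perm (ev a w).
Proof.
apply/permP=> z; case: (boolP (z \in codom f)) => [/codomP[x ->]|zN].
  rewrite embed_permE; elim: w x => [|e w IH] x; first by rewrite !ev_perm_nil.
  by rewrite !ev_permM embed_permE IH.
rewrite [RHS]embed_perm_out //; elim: w => [|e w IH]; first by rewrite ev_perm_nil.
by rewrite ev_permM embed_perm_out.
Qed.

Lemma embed_perm_inj : injective embed_perm.
Proof.
move=> s t st; apply/permP=> x; apply: f_inj.
by rewrite -!embed_permE st.
Qed.
End EmbedPerm.

(** * Universal actions of bounded degree *)

Section Universal.
Variables (E : finType) (M : nat) (C : {ffun E -> {perm 'I_M}} -> Prop).

(** The disjoint union of all actions on [M] points that satisfy [C]; an action violating [C]
    contributes only fixed points. *)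
Definition univ_fun (e : E) (x : {ffun E -> {perm 'I_M}} * 'I_M) :=
  (x.1, if `[< C x.1 >] then x.1 e x.2 else x.2).

Lemma univ_fun_inj e : injective (univ_fun e).
Proof.
move=> [a x] [b y] [/= ->]; case: ifP => _; last by move->.
by move/perm_inj ->.
Qed.

Definition univ (e : E) : {perm _} := perm (@univ_fun_inj e).

Lemma ev_univ w a x :
  ev univ w (a, x) = (a, if `[< C a >] then ev a w x else x).
Proof.
elim: w x => [|e w IH] x; first by rewrite !ev_nil !perm1; case: ifP.
rewrite [ev univ _]ev_cons [ev a _]ev_cons !permM permE /univ_fun /= IH.
by case: `[< C a >].
Qed.

Lemma univ_eqP w w' :
  ev univ w = ev univ w' <-> (forall a, C a -> ev a w = ev a w').
Proof.
split=> [ww' a Ca|H]; apply/permP.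
  move=> x; move/permP/(_ (a, x)): ww'; rewrite !ev_univ.
  by rewrite (asboolT Ca) => -[].
by case=> a x; rewrite !ev_univ; case: asboolP => // Ca; rewrite H.
Qed.
End Universal.

Section UniversalFactors.
Variables (E J : finType) (A : J -> pred E) (bT : finGroupType) (b : E -> bT).
Variable M : nat.

Definition ufact : E -> {perm {ffun E -> {perm 'I_M}} * 'I_M} :=
  univ (fun a => forall j, factors (A j) b a).

Lemma ufact_factors j : factors (A j) b ufact.
Proof.
move=> w w' Aw Aw' bww'; apply/univ_eqP => a Ca.
exact: (Ca j).
Qed.

(** Carried to ['I_M] with the remaining points fixed, the action [a] becomes one of the components
    of the universal action. *)
Lemma ufactP (X : finType) (a : E -> {perm X}) w w' :
    #|X| <= M -> (forall j, factors (A j) b a) ->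
  ev ufact w = ev ufact w' -> ev a w = ev a w'.
Proof.
move=> XM aC /univ_eqP H.
pose f (x : X) : 'I_M := widen_ord XM (enum_rank x).
have f_inj : injective f.
  by move=> x y /(congr1 val) /= xy; apply/enum_rank_inj/val_inj.
pose a' := [ffun e => embed_perm f_inj (a e)].
have a'E v : ev a' v = embed_perm f_inj (ev a v).
  by rewrite -ev_embed; apply: eq_bigr => e _; rewrite ffunE.
apply: (embed_perm_inj (f_inj := f_inj)).
rewrite -!a'E; apply: H => j u u' Au Au' uu'.
by rewrite !a'E (aC j u u').
Qed.
End UniversalFactors.

(** * First level: independent subgroups for pairs of colours *)

Section PairLevel.
Variables (E I : finType) (inc : E -> pred I).
Hypothesis inc2 : forall e i j l,
  inc e i -> inc e j -> inc e l -> [|| i == j, i == l | j == l].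
Definition at1 (i : I) : pred E := fun e => inc e i.
Definition at2 (i j : I) : pred E := fun e => inc e i && inc e j.

Lemma at2C i j : at2 i j =1 at2 j i.
Proof. by move=> e; apply: andbC. Qed.

Lemma all_at2l i j w : all (at2 i j) w -> all (at1 i) w.
Proof. by apply: sub_all => e /andP[]. Qed.

Lemma all_at2r i j w : all (at2 i j) w -> all (at1 j) w.
Proof. by apply: sub_all => e /andP[]. Qed.

Section Subgroups.
Variables (gT : finGroupType) (d : E -> gT).

Definition Dside i : {group gT} := <<[set d e | e in at1 i]>>%G.
Definition Dpair i j : {group gT} := <<[set d e | e in at2 i j]>>%G.

Lemma Dpair_sub i j : Dpair i j \subset Dside i.
Proof.
apply/genS/subsetP=> _ /imsetP[e /andP[ei _] ->].
by apply: imset_f.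
Qed.

Lemma DpairC i j : Dpair i j = Dpair j i.
Proof.
congr <<_>>%G; apply/setP=> x; apply/imsetP/imsetP => -[e Ae ->]; exists e => //;
  by rewrite -topredE /= at2C.
Qed.

Lemma DsideP i g : reflect (exists2 w, all (at1 i) w & g = ev d w) (g \in Dside i).
Proof.
by apply: (iffP idP) => [|[w Aw ->]]; [apply: genE | apply: ev_in].
Qed.

Lemma DpairP i j g :
  reflect (exists2 w, all (at2 i j) w & g = ev d w) (g \in Dpair i j).
Proof.
by apply: (iffP idP) => [|[w Aw ->]]; [apply: genE | apply: ev_in].
Qed.

Lemma Dside_gen i e : inc e i -> d e \in Dside i.
Proof. by move=> ei; apply/mem_gen/imset_f. Qed.

Lemma Dpair_gen i j e : inc e i -> inc e j -> d e \in Dpair i j.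
Proof. by move=> ei ej; apply/mem_gen/imset_f; apply/andP. Qed.

End Subgroups.

Variables (B : finGroupType) (v : E -> B) (M : nat).

Definition pair_compat (X : finType) (a : E -> {perm X}) : Prop :=
  forall i j, i != j -> factors (at2 i j) v a.

Definition dperm : E -> {perm _} :=
  ufact (fun p : I * I => [pred e | (p.1 != p.2) && at2 p.1 p.2 e]) v M.

(** The second coordinate keeps [v] as a quotient; on words over one pair of colours it determines
    the first. *)
Definition dgen (e : E) := ((dperm e, v e) : (_ * B)%type).

Lemma dgen_factors i j : i != j -> factors (at2 i j) v dgen.
Proof.
move=> ij w w' Aw Aw' ww'; rewrite !ev_pair ww'; congr (_, _).
by apply: (@ufact_factors _ _ _ _ _ _ (i, j)); rewrite //= ij.
Qed.

Lemma dgenP (X : finType) (a : E -> {perm X}) w w' :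
  #|X| <= M -> pair_compat a -> ev dgen w = ev dgen w' -> ev a w = ev a w'.
Proof.
move=> XM aC; rewrite !ev_pair => -[ww' _].
apply: (ufactP XM _ ww') => -[i j] u u' /=.
case: eqP => [_|/eqP ij] /=; last exact: aC.
by case: u u' => [|? ?] [|? ?].
Qed.

Section Retract.
Variables (i j : I).
Hypothesis ij : i != j.
Hypothesis BM : #|B| <= M.

(** Applied to [1], this action reads off the [v]-value of a word after erasing all letters that are
    not between [i] and [j]. *)
Definition loop_act (e : E) : {perm B} :=
  if at2 i j e then perm (@mulIg B (v e)) else 1.

Lemma ev_loop w y : ev loop_act w y = y * ev v (filter (at2 i j) w).
Proof.
elim: w y => [|e w IH] y; first by rewrite ev_perm_nil ev_nil mulg1.
rewrite ev_permM {}IH /loop_act /=; case: ifP => _; last by rewrite perm1.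
by rewrite ev_cons mulgA permE.
Qed.

(** A letter touches at most two colours, so a letter between [i'] and [j'] lies between [i] and [j]
    only if the two pairs coincide. *)
Lemma filter_at2 i' j' w : i' != j' -> all (at2 i' j') w ->
  filter (at2 i j) w =
    if (i, j) \in [:: (i', j'); (j', i')] then w else [::].
Proof.
move=> ij'; rewrite !inE !xpair_eqE; case: ifP => [H|H].
  move=> Aw; apply/all_filterP; apply: sub_all Aw => e.
  by rewrite /at2 => /andP[xi xj]; case/orP: H => /andP[/eqP-> /eqP->]; rewrite xi xj.
elim: w => //= e w IH /andP[/andP[ei' ej'] /IH ->].
case: ifP => // /andP[ei ej].
have {}ei' : (i == i') || (j == i').
  by have := inc2 ei ej ei'; rewrite (negbTE ij).
have {}ej' : (i == j') || (j == j').
  by have := inc2 ei ej ej'; rewrite (negbTE ij).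
move: H ij'.
by case/orP: ei' => /eqP<-; case/orP: ej' => /eqP<-; rewrite !eqxx ?orbT.
Qed.

Lemma loop_compat : pair_compat loop_act.
Proof.
move=> i' j' ij' w w' Aw Aw' ww'; apply/permP=> y; rewrite !ev_loop.
rewrite !(filter_at2 ij') //; case: ifP => //.
by rewrite ww'.
Qed.

Lemma retract w w' : ev dgen w = ev dgen w' ->
  ev v (filter (at2 i j) w) = ev v (filter (at2 i j) w').
Proof.
move/(dgenP BM loop_compat)/permP/(_ 1).
by rewrite !ev_loop !mul1g.
Qed.

End Retract.

Lemma card_Dpair i j : i != j -> #|Dpair dgen i j| <= #|B|.
Proof.
move=> ij.
suff inj : {in Dpair dgen i j &, injective snd}.
  by rewrite -(card_in_imset inj) max_card.
move=> x y /DpairP[w Aw ->] /DpairP[w' Aw' ->].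
rewrite !ev_pair /= => ww'.
by have := dgen_factors ij Aw Aw' ww'; rewrite !ev_pair.
Qed.

(** The retraction to the pair [i], [j] keeps the word over [i], [j] and erases the word over [i],
    [l]. *)
Lemma Dpair_trivI i j l g : #|B| <= M -> i != j -> i != l -> j != l ->
  g \in Dpair dgen i j -> g \in Dpair dgen i l -> g = 1.
Proof.
move=> BM ij il jl /DpairP[w Aw ->] /DpairP[w' Aw' ww'].
rewrite -(ev_nil dgen); apply: (dgen_factors ij) => //.
have := retract ij BM ww'; rewrite (filter_at2 ij il Aw') (all_filterP Aw).
rewrite !inE !xpair_eqE eqxx (negbTE jl) (negbTE il) /=; exact.
Qed.

(* Letters outside [at1 l] are made to act trivially, so only the closed set
   [O] has to be small. *)
Lemma orbit_factors (X : finType) (a : E -> {perm X}) (l : I) (O : {set X}) :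
    pair_compat a -> #|O| <= M ->
    (forall e x, inc e l -> x \in O -> a e x \in O) ->
  forall w w', all (at1 l) w -> all (at1 l) w' -> ev dgen w = ev dgen w' ->
    {in O, ev a w =1 ev a w'}.
Proof.
move=> aC OM Ocl w w' Aw Aw' ww' x xO.
pose S := {x : X | x \in O}.
have Ocl' e (y : S) : (if inc e l then a e (val y) else val y) \in O.
  by case: ifP => el; [apply: Ocl; [|exact: valP] | exact: valP].
pose f e (y : S) : S := exist (fun x => is_true (x \in O)) _ (Ocl' e y).
have f_inj e : injective (f e).
  move=> y z /(congr1 val) /=; case: ifP => _.
    by move/perm_inj/val_inj.
  exact: val_inj.
pose a' e : {perm S} := perm (@f_inj e).
have a'E u (y : S) : all (at1 l) u -> val (ev a' u y) = ev a u (val y).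
  elim: u y => [|e u IH] y; first by rewrite !ev_perm_nil.
  by case/andP=> /= el Au; rewrite !ev_permM IH // permE /= ifT.
have a'1 u : all (fun e => ~~ inc e l) u -> ev a' u = 1.
  elim: u => [|e u IH] /=; first by rewrite ev_nil.
  case/andP=> el /IH; rewrite ev_cons => ->; rewrite mulg1.
  apply/permP=> y; rewrite permE perm1; apply: val_inj.
  by rewrite /= (negbTE el).
have a'C : pair_compat a'.
  move=> i j ij u u' Au Au' uu'.
  have [lij|] := boolP ((l == i) || (l == j)).
    have Al s : all (at2 i j) s -> all (at1 l) s.
      by case/orP: lij => /eqP->; [apply: all_at2l | apply: all_at2r].
    apply/permP=> y; apply: val_inj; rewrite !a'E ?Al //.
    by rewrite (aC i j ij u u').
  rewrite negb_or => /andP[li lj].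
  have Al s : all (at2 i j) s -> all (fun e => ~~ inc e l) s.
    apply: sub_all => e /andP[ei ej]; apply: contraNN ij => el.
    have := inc2 ei ej el.
    by rewrite ![_ == l]eq_sym (negbTE li) (negbTE lj) !orbF.
  by rewrite !a'1 ?Al.
have SM : #|{: S}| <= M by rewrite card_sig.
have := dgenP SM a'C ww'.
move/permP/(_ (exist (fun x => is_true (x \in O)) x xO))/(congr1 val).
by rewrite !a'E.
Qed.
End PairLevel.

(** * Gluing Cayley graphs along cosets *)

Section Gluing.
Variables (E I : finType) (inc : E -> pred I).
Hypothesis inc2 : forall e i j l,
  inc e i -> inc e j -> inc e l -> [|| i == j, i == l | j == l].
Variables (B : finGroupType) (v : E -> B) (D : finGroupType) (d : E -> D).
Variables (M nB : nat).

Local Notation at1 := (at1 inc).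
Local Notation at2 := (at2 inc).
Local Notation Dside := (Dside inc d).
Local Notation Dpair := (Dpair inc d).

Definition closed_at (X : finType) (a : E -> {perm X}) (l : I) (Y : {set X}) :=
  [forall x in Y, forall e, inc e l ==> (a e x \in Y)].

Hypothesis d_pair : forall i j, i != j -> factors (at2 i j) v d.
Hypothesis d_card : forall i j, i != j -> #|Dpair i j| <= nB.
Hypothesis d_triv : forall i j l g, i != j -> i != l -> j != l ->
  g \in Dpair i j -> g \in Dpair i l -> g = 1.
Hypothesis d_orb : forall (X : finType) (a : E -> {perm X}) l (Y : {set X}),
    pair_compat inc v a -> closed_at a l Y -> #|Y| <= M ->
  forall w w', all (at1 l) w -> all (at1 l) w' -> ev d w = ev d w' ->
    {in Y, ev a w =1 ev a w'}.

Definition side_compat (X : finType) (a : E -> {perm X}) : Prop :=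
  forall l, factors (at1 l) d a.

(* The last piece of a chain: [iota] embeds the Cayley graph of [Dside j], and
   [Dd] is its overlap with the previous piece.  The orbits through the free
   part are small, so that further pieces can be attached there. *)
Record tail_piece (X : finType) (a : E -> {perm X}) (j : I) (iota : D -> X)
    (Dd : {set D}) (m : nat) : Prop := {
  tp_compat : side_compat a;
  tp_inj : {in Dside j &, injective iota};
  tp_act : forall e x, inc e j -> x \in Dside j -> a e (iota x) = iota (x * d e);
  tp_fix : forall e x, ~~ inc e j -> x \in Dside j -> x \notin Dd ->
    a e (iota x) = iota x;
  tp_orb : forall l x, l != j -> x \in Dside j -> x \notin Dd ->
    exists Y : {set X}, [/\ closed_at a l Y, #|Y| <= m & iota x \in Y] }.

Lemma closed_atP (X : finType) (a : E -> {perm X}) l (Y : {set X}) e x :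
  closed_at a l Y -> inc e l -> (a e x \in Y) = (x \in Y).
Proof.
move/forall_inP => clY el.
have aY y : y \in Y -> a e y \in Y by move=> /clY/forallP/(_ e)/implyP; apply.
apply/idP/idP; last exact: aY.
have /eqP YE : [set a e y | y in Y] == Y.
  rewrite eqEcard card_imset ?leqnn ?andbT; last exact: perm_inj.
  by apply/subsetP=> _ /imsetP[y /aY yY ->].
by rewrite -{1}YE => /imsetP[y yY /perm_inj ->].
Qed.

Section Glue.
Variables (X : finType) (a : E -> {perm X}) (j : I) (iota : D -> X).
Variables (Dd : {set D}) (m : nat).
Hypothesis tp : tail_piece a j iota Dd m.
Variables (h : D) (j' : I).
Hypothesis hj : h \in Dside j.
Hypothesis jj' : j != j'.
Hypothesis h_free : forall b, b \in Dpair j j' -> h * b \notin Dd.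
Hypothesis m_gt0 : 0 < m.
Hypothesis mM : m * nB.+1 <= M.

Local Notation F0 := (Dpair j j').
Local Notation S' := (Dside j').

Lemma F0j x : x \in F0 -> x \in Dside j.
Proof. exact: subsetP (Dpair_sub inc d j j') x. Qed.

Lemma F0j' x : x \in F0 -> x \in S'.
Proof. by rewrite DpairC; apply: subsetP (Dpair_sub inc d j' j) x. Qed.

Lemma hF0 x : x \in F0 -> h * x \in Dside j.
Proof. by move=> /F0j; apply: groupM. Qed.

Definition kappa (x : D) : X + D := if x \in F0 then inl (iota (h * x)) else inr x.

Definition old_fun (e : E) (z : X + D) : X + D :=
  if z is inl x then inl (a e x) else z.

(* The coset [h * Dpair j j'] of the old piece is identified with the subgroup
   [Dpair j j'] of the new one; the points [inr x] with [x] outside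
   [Dside j' :\: Dpair j j'] are junk and stay fixed. *)
Definition glue_fun (e : E) (z : X + D) : X + D :=
  if inc e j' then
    if [pick x in S' | kappa x == z] is Some x then kappa (x * d e)
    else old_fun e z
  else old_fun e z.

Definition onK (z : X + D) := [exists x in S', kappa x == z].

Lemma kappa_inj : {in S' &, injective kappa}.
Proof.
move=> x y xS yS; rewrite /kappa; case: ifP => xF; case: ifP => yF //.
  by case=> /(tp_inj tp)-/(_ (hF0 xF) (hF0 yF))/mulgI.
by case.
Qed.

Lemma kappa_onK x : x \in S' -> onK (kappa x).
Proof. by move=> xS; apply/existsP; exists x; rewrite xS eqxx. Qed.

Lemma glue_kappa e x : inc e j' -> x \in S' -> glue_fun e (kappa x) = kappa (x * d e).
Proof.
move=> ej xS; rewrite /glue_fun ej; case: pickP => [y /andP[yS /eqP]|/(_ x)].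
  by move/(kappa_inj yS xS) ->.
by rewrite xS eqxx.
Qed.

Lemma glue_old e z : ~~ onK z -> glue_fun e z = old_fun e z.
Proof.
move=> zK; rewrite /glue_fun; case: ifP => // _; case: pickP => // x xP.
by case/negP: zK; apply/existsP; exists x.
Qed.

Lemma glue_ninc e z : ~~ inc e j' -> glue_fun e z = old_fun e z.
Proof. by rewrite /glue_fun => /negbTE ->. Qed.

Lemma onK_inl x : onK (inl x) -> exists2 b, b \in F0 & x = iota (h * b).
Proof.
case/existsP=> b /andP[bS]; rewrite /kappa; case: ifP => // bF /eqP[<-].
by exists b.
Qed.

Lemma onK_inr x : onK (inr x) -> x \in S' /\ x \notin F0.
Proof.
case/existsP=> b /andP[bS]; rewrite /kappa; case: ifP => // bF /eqP[<-].
by rewrite bF.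
Qed.

Lemma iota_onK b : b \in F0 -> onK (inl (iota (h * b))).
Proof.
move=> bF; apply/existsP; exists b.
by rewrite (F0j' bF) /kappa bF eqxx.
Qed.

(** On the coset to be glued, a letter at [j'] either moves as in the new piece already or is a
    loop, free to be redirected; the latter uses that the coset avoids [Dd]. *)
Lemma old_iota e b : inc e j' -> b \in F0 ->
  a e (iota (h * b)) = iota (h * (if inc e j then b * d e else b)).
Proof.
move=> ej' bF; case: ifP => ej; first by rewrite (tp_act tp) ?hF0 // mulgA.
by rewrite (tp_fix tp) ?ej ?hF0 ?h_free.
Qed.

(** Letters at [j'] permute the glued coset, hence also the points off the new piece; this makes
    [glue_fun] injective. *)
Lemma old_onK e z : inc e j' -> ~~ onK z -> ~~ onK (old_fun e z).
Proof.
move=> ej'; case: z => // x; apply: contraNN => /= /onK_inl[b bF].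
pose c := if inc e j then b * (d e)^-1 else b.
have cF : c \in F0.
  rewrite /c; case: ifP => // ej.
  by rewrite groupM ?groupV ?Dpair_gen.
have -> : iota (h * b) = a e (iota (h * c)).
  by rewrite old_iota // /c; case: (inc e j); rewrite ?mulgKV.
by move/perm_inj->; apply: iota_onK.
Qed.

Lemma old_inj e : injective (old_fun e).
Proof. by move=> [x|x] [y|y] //=; case=> /perm_inj->. Qed.

Lemma glue_fun_inj e : injective (glue_fun e).
Proof.
move=> y z; case: (boolP (inc e j')) => ej'; last first.
  by rewrite !glue_ninc //; apply: old_inj.
have deS x : x \in S' -> x * d e \in S' by move=> xS; rewrite groupM ?Dside_gen.
case: (boolP (onK y)) => [/existsP[x /andP[xS /eqP<-]]|yK];
  case: (boolP (onK z)) => [/existsP[x' /andP[xS' /eqP<-]]|zK];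
  rewrite ?glue_kappa ?glue_old //.
- by move/(kappa_inj (deS _ xS) (deS _ xS'))/mulIg->.
- by move=> E0; have := old_onK ej' zK; rewrite -E0 kappa_onK ?deS.
- by move=> E0; have := old_onK ej' yK; rewrite E0 kappa_onK ?deS.
exact: old_inj.
Qed.

Definition glue (e : E) : {perm X + D} := perm (@glue_fun_inj e).

Definition old_ev w (z : X + D) : X + D :=
  if z is inl x then inl (ev a w x) else z.

Lemma ev_glue_kappa w x : all (at1 j') w -> x \in S' ->
  ev glue w (kappa x) = kappa (x * ev d w).
Proof.
elim: w x => [|e w IH] x; first by rewrite ev_perm_nil ev_nil mulg1.
case/andP=> /= ej Aw xS; rewrite ev_permM permE glue_kappa // ev_cons mulgA.
by rewrite IH // groupM ?Dside_gen.
Qed.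

Lemma ev_glue_old (P : X + D -> Prop) (A : pred E) w z :
    (forall e z, A e -> P z -> glue_fun e z = old_fun e z /\ P (old_fun e z)) ->
  all A w -> P z -> ev glue w z = old_ev w z.
Proof.
move=> PA; elim: w z => [|e w IH] z.
  by rewrite ev_perm_nil; case: z => //= x; rewrite ev_perm_nil.
case/andP=> Ae Aw Pz; rewrite ev_permM permE; have [-> Pz'] := PA _ _ Ae Pz.
by rewrite IH //; case: z {Pz Pz'} => //= x; rewrite ev_permM.
Qed.

Lemma old_ev_eq l w w' z : all (at1 l) w -> all (at1 l) w' ->
  ev d w = ev d w' -> old_ev w z = old_ev w' z.
Proof.
by move=> Aw Aw' ww'; case: z => //= x; rewrite (tp_compat tp Aw Aw' ww').
Qed.

Lemma glue_factors_new : factors (at1 j') d glue.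
Proof.
move=> w w' Aw Aw' ww'; apply/permP=> z.
case: (boolP (onK z)) => [/existsP[x /andP[xS /eqP<-]]|zK].
  by rewrite !ev_glue_kappa // ww'.
have E0 u : all (at1 j') u -> ev glue u z = old_ev u z.
  move=> Au; apply: (@ev_glue_old (fun z => ~~ onK z) (at1 j')) => //.
  by move=> e y ej yK; rewrite glue_old // old_onK.
by rewrite !E0 //; apply: (@old_ev_eq j').
Qed.

(** Proved before compatibility with whole sides, since it is what allows [d_orb] to be applied to
    [glue] on small closed sets. *)
Lemma glue_pair_compat : pair_compat inc v glue.
Proof.
move=> i1 i2 i12 w w' Aw Aw' vww'; have ww' := d_pair i12 Aw Aw' vww'.
have [ji|] := boolP ((j' == i1) || (j' == i2)).
  have Al s : all (at2 i1 i2) s -> all (at1 j') s.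
    by case/orP: ji => /eqP->; [apply: all_at2l | apply: all_at2r].
  by apply: glue_factors_new => //; apply: Al.
rewrite negb_or => /andP[ji1 ji2]; apply/permP=> z.
have E0 u : all (at2 i1 i2) u -> ev glue u z = old_ev u z.
  move=> Au; apply: (@ev_glue_old (fun=> True) (at2 i1 i2)) => //.
  move=> e y /andP[e1 e2] _; rewrite glue_ninc //.
  apply: contraNN i12 => ej; have := inc2 e1 e2 ej.
  by rewrite ![_ == j']eq_sym (negbTE ji1) (negbTE ji2) !orbF.
rewrite !E0 //; apply: (@old_ev_eq i1) => //.
  exact: all_at2l Aw.
exact: all_at2l Aw'.
Qed.

Section OtherSide.
Variable l : I.
Hypothesis lj' : l != j'.
Local Notation F1 := (Dpair j' l).

Lemma glue_orb (Y : {set X + D}) w w' : closed_at glue l Y ->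
    #|Y| <= m * nB.+1 ->
  all (at1 l) w -> all (at1 l) w' -> ev d w = ev d w' ->
  {in Y, ev glue w =1 ev glue w'}.
Proof.
move=> clY cY; apply: (d_orb glue_pair_compat clY).
exact: leq_trans mM.
Qed.

Definition new_orb (g : D) : {set X + D} := [set inr (g * c) | c in F1].

Lemma new_orb_card g : #|new_orb g| <= m * nB.+1.
Proof.
apply: leq_trans (leq_imset_card _ _) _.
apply: leq_trans (d_card _) _; first by rewrite eq_sym.
by apply: leq_trans (leq_pmull _ m_gt0); apply: leqW.
Qed.

Lemma new_orb_closed g : (forall c, c \in F1 -> g * c \notin F0) ->
  closed_at glue l (new_orb g).
Proof.
move=> gF; apply/forall_inP => _ /imsetP[c cF ->]; apply/forallP=> e.
have cO : inr (g * c) \in new_orb g by apply/imsetP; exists c.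
apply/implyP=> el; rewrite permE.
case: (boolP (inc e j')) => ej; last by rewrite glue_ninc.
have dF : c * d e \in F1 by rewrite groupM ?Dpair_gen.
case: (boolP (onK (inr (g * c)))) => [/onK_inr[gcS gcF]|gcK].
  have {1}-> : inr (g * c) = kappa (g * c) by rewrite /kappa (negbTE gcF).
  rewrite glue_kappa // /kappa -mulgA (negbTE (gF _ dF)).
  by apply/imsetP; exists (c * d e).
by rewrite glue_old.
Qed.

Lemma new_orb_mem g : inr g \in new_orb g.
Proof. by apply/imsetP; exists 1; rewrite ?mulg1. Qed.

Section Mixed.
Variable Y : {set X}.
Hypothesis lj : l != j.
Hypothesis clY : closed_at a l Y.
Hypothesis cY : #|Y| <= m.

Definition mixed_base := [set b in F0 | iota (h * b) \in Y].

(** A closed set across the gluing: to each of the at most [m] points of [Y] in the glued coset a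
    coset of [Dpair j' l] is attached, whence the bound [m * nB.+1]. By [F01_triv] the attached
    coset returns to the overlap only at its base point. *)
Definition mixed_orb : {set X + D} :=
  [set inl x | x in Y] :|: [set inr (p.1 * p.2) | p in setX mixed_base F1].

Lemma mixed_inl x : x \in Y -> inl x \in mixed_orb.
Proof. by move=> xY; rewrite inE imset_f. Qed.

Lemma mixed_inr b c : b \in mixed_base -> c \in F1 -> inr (b * c) \in mixed_orb.
Proof.
by move=> bB cF; apply/setUP; right; apply/imsetP; exists (b, c); rewrite // inE bB.
Qed.

Lemma mixed_card : #|mixed_orb| <= m * nB.+1.
Proof.
rewrite mulnS; apply: leq_trans (leq_card_setU _ _) _; apply: leq_add.
  exact: leq_trans (leq_imset_card _ _) cY.
apply: leq_trans (leq_imset_card _ _) _; rewrite cardsX.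
apply: leq_mul; last by apply: d_card; rewrite eq_sym.
apply: leq_trans cY.
have inj : {in mixed_base &, injective (fun b => iota (h * b))}.
  move=> b c; rewrite !inE => /andP[bF _] /andP[cF _].
  by move/(tp_inj tp (hF0 bF) (hF0 cF))/mulgI.
rewrite -(card_in_imset inj); apply: subset_leq_card.
by apply/subsetP=> x /imsetP[b]; rewrite inE => /andP[_ bY] ->.
Qed.

Lemma F01_triv x : x \in F0 -> x \in F1 -> x = 1.
Proof.
by rewrite (DpairC inc d j) => xF xF'; apply: (d_triv _ _ _ xF xF'); rewrite eq_sym.
Qed.

Lemma mixed_kappa b c : b \in mixed_base -> c \in F1 ->
  kappa (b * c) \in mixed_orb.
Proof.
move=> bB cF; have := bB; rewrite inE => /andP[bF bY].
rewrite /kappa; case: ifP => bcF; last exact: mixed_inr.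
have c1 : c = 1 by apply: F01_triv => //; rewrite -(groupMl _ bF).
by rewrite c1 mulg1 mixed_inl.
Qed.

Lemma mixed_closed : closed_at glue l mixed_orb.
Proof.
apply/forall_inP => z zM; apply/forallP=> e; apply/implyP=> el; rewrite permE.
have old_mixed : old_fun e z \in mixed_orb.
  case/setUP: zM => [/imsetP[x xY ->]|/imsetP[[b c]]] /=.
    by rewrite mixed_inl // (closed_atP _ clY).
  by rewrite inE /= => /andP[bB cF] ->; apply: mixed_inr.
have [ej|ej] := boolP (inc e j'); last by rewrite glue_ninc.
have [zK|zK] := boolP (onK z); last by rewrite glue_old.
have dF : d e \in F1 by rewrite Dpair_gen.
case/setUP: zM => [/imsetP[x xY Ez]|/imsetP[[b c]]].
  have [b bF Ex] : exists2 b, b \in F0 & x = iota (h * b).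
    by apply: onK_inl; rewrite -Ez.
  have -> : z = kappa b by rewrite Ez /kappa bF Ex.
  rewrite glue_kappa ?F0j' //; apply: mixed_kappa => //.
  by rewrite inE bF -Ex.
rewrite inE /= => /andP[bB cF] Ez.
have [bcS bcF] : b * c \in S' /\ b * c \notin F0.
  by apply: onK_inr; rewrite -Ez.
have -> : z = kappa (b * c) by rewrite Ez /kappa (negbTE bcF).
by rewrite glue_kappa // -mulgA mixed_kappa // groupM.
Qed.
End Mixed.

(** The coset of [x] under [Dpair j' l] either misses the overlap and is closed by itself, or meets
    it in some [b] and is absorbed in the small closed set through the old point of [b]. *)
Lemma new_node_orb x : x \in S' -> x \notin F0 ->
  exists Y : {set X + D}, [/\ closed_at glue l Y, #|Y| <= m * nB.+1 & inr x \in Y].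
Proof.
move=> xS xF; have [lj|lj] := eqVneq l j.
  exists (new_orb x); rewrite new_orb_card new_orb_mem; split=> //.
  apply: new_orb_closed => c; rewrite lj (DpairC inc d j') => cF.
  by rewrite groupMr.
have [/existsP[b /andP[bF bx]]|bF] := boolP [exists b in F0, b^-1 * x \in F1].
  have [Y [clY cY xY]] := tp_orb tp lj (hF0 bF) (h_free bF).
  exists (mixed_orb Y); rewrite mixed_card // ; split=> //.
    exact: mixed_closed.
  have := @mixed_kappa Y lj b (b^-1 * x).
  by rewrite inE bF xY mulKVg /kappa (negbTE xF); apply.
exists (new_orb x); rewrite new_orb_card new_orb_mem; split=> //.
apply: new_orb_closed => c cF; apply: contraNN bF => xcF.
apply/existsP; exists (x * c); rewrite xcF invMg -mulgA mulVg mulg1.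
by rewrite groupV.
Qed.

(** Every point either lies in a closed set small enough for [d_orb] or moves by the old action
    under all letters at [l]. *)
Lemma glue_factors_other : factors (at1 l) d glue.
Proof.
move=> w w' Aw Aw' ww'; apply/permP=> -[x|x]; last first.
  have [xK|xK] := boolP (onK (inr x)); last first.
    suff E0 u : ev glue u (inr x) = old_ev u (inr x) by rewrite !E0.
    apply: (@ev_glue_old (fun z => z = inr x) predT); rewrite ?all_predT //.
    by move=> e z _ ->; rewrite glue_old.
  have [xS xF] := onK_inr xK.
  have [Y [clY cY xY]] := new_node_orb xS xF.
  exact: (glue_orb clY).
have [lj|lj] := eqVneq l j.
  have E0 u : all (at1 l) u -> ev glue u (inl x) = old_ev u (inl x).
    move=> Au; apply: (@ev_glue_old (fun z => exists y, z = inl y) (at1 l)) => //;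
      last by exists x.
    move=> e _ el [y ->]; split; last by exists (a e y).
    have [yK|yK] := boolP (onK (inl y)); last by rewrite glue_old.
    have [ej|ej] := boolP (inc e j'); last by rewrite glue_ninc.
    have [b bF Ey] := onK_inl yK; have {1}-> : inl y = kappa b by rewrite /kappa bF Ey.
    rewrite /at1 lj in el.
    rewrite glue_kappa ?F0j' // /kappa groupMl // Dpair_gen //=.
    by rewrite Ey old_iota // el.
  by rewrite !E0 //; apply: (@old_ev_eq l).
(* By [tp_orb] every point of the glued coset is bad, and badness is invariant under letters at [l];
   the other old points never notice the gluing. *)
pose bad y := [exists Y : {set X}, [&& closed_at a l Y, #|Y| <= m, y \in Y
  & [exists b in F0, iota (h * b) \in Y]]].
have [/existsP[Y /and4P[clY cY xY _]]|xB] := boolP (bad x).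
  apply: (@glue_orb (mixed_orb Y)) => //; first exact: mixed_closed.
    exact: mixed_card.
  exact: mixed_inl.
have E0 u : all (at1 l) u -> ev glue u (inl x) = old_ev u (inl x).
  move=> Au; apply: (@ev_glue_old (fun z => exists2 y, z = inl y & ~~ bad y)
    (at1 l)) => //; last by exists x.
  move=> e _ el [y -> yB]; split; last first.
    exists (a e y) => //; apply: contraNN yB => /existsP[Y /and4P[clY cY xY bY]].
    by apply/existsP; exists Y; rewrite clY cY bY -(closed_atP _ clY el) xY.
  rewrite glue_old //; apply: contraNN yB => /onK_inl[b bF ->].
  have [Y [clY cY bY]] := tp_orb tp lj (hF0 bF) (h_free bF).
  apply/existsP; exists Y; rewrite clY cY bY; apply/existsP; exists b.
  by rewrite bF.
by rewrite !E0 //; apply: (@old_ev_eq l).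
Qed.
End OtherSide.

Lemma glue_tail : tail_piece glue j' kappa F0 (m * nB.+1).
Proof.
split.
- move=> l; have [->|lj'] := eqVneq l j'; first exact: glue_factors_new.
  exact: glue_factors_other.
- exact: kappa_inj.
- by move=> e x ej xS; rewrite permE glue_kappa.
- move=> e x ej xS xF; rewrite permE glue_ninc // /kappa (negbTE xF) //.
- move=> l x lj' xS xF; rewrite /kappa (negbTE xF); exact: new_node_orb.
Qed.
End Glue.


Section FirstPiece.
Variable j : I.
Hypothesis nBM : nB <= M.

Definition base_act (e : E) : {perm D} :=
  if inc e j then perm (@mulIg D (d e)) else 1.

Lemma base_actE e x : base_act e x = if inc e j then x * d e else x.
Proof. by rewrite /base_act; case: ifP; rewrite (permE, perm1). Qed.

Lemma ev_base w x : all (at1 j) w -> ev base_act w x = x * ev d w.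
Proof.
elim: w x => [|e w IH] x; first by rewrite ev_perm_nil ev_nil mulg1.
case/andP=> /= ej Aw; rewrite ev_permM base_actE ifT // IH // ev_cons mulgA //.
Qed.

Lemma base_factors : factors (at1 j) d base_act.
Proof. by move=> w w' Aw Aw' ww'; apply/permP=> x; rewrite !ev_base ?ww'. Qed.

Lemma base_pair_compat : pair_compat inc v base_act.
Proof.
move=> i1 i2 i12 w w' Aw Aw' vww'; have ww' := d_pair i12 Aw Aw' vww'.
have [ji|] := boolP ((j == i1) || (j == i2)).
  have Al s : all (at2 i1 i2) s -> all (at1 j) s.
    by case/orP: ji => /eqP->; [apply: all_at2l | apply: all_at2r].
  by apply: base_factors => //; apply: Al.
rewrite negb_or => /andP[ji1 ji2].
have E0 u : all (at2 i1 i2) u -> ev base_act u = 1.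
  elim: u => [|e u IH] /=; first by rewrite ev_nil.
  case/andP=> /andP[e1 e2] /IH; rewrite ev_cons => ->; rewrite mulg1.
  rewrite /base_act ifF //; apply: contraNF i12 => ej; have := inc2 e1 e2 ej.
  by rewrite ![_ == j]eq_sym (negbTE ji1) (negbTE ji2) !orbF.
by rewrite !E0.
Qed.

Lemma base_orb l x : l != j -> exists Y : {set D},
  [/\ closed_at base_act l Y, #|Y| <= nB & x \in Y].
Proof.
move=> lj; exists [set x * c | c in Dpair j l]; split.
- apply/forall_inP => _ /imsetP[c cF ->]; apply/forallP=> e; apply/implyP=> el.
  rewrite base_actE; case: ifP => ej; last exact: imset_f.
  by rewrite -mulgA imset_f // groupM // Dpair_gen.
- apply: leq_trans (leq_imset_card _ _) _; apply: d_card.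
  by rewrite eq_sym.
by apply/imsetP; exists 1; rewrite ?mulg1.
Qed.

Lemma base_tail : tail_piece base_act j id set0 nB.
Proof.
split=> //.
- move=> l; have [->|lj] := eqVneq l j; first exact: base_factors.
  move=> w w' Aw Aw' ww'; apply/permP=> x.
  have [Y [clY cY xY]] := base_orb x lj.
  exact: (d_orb base_pair_compat clY (leq_trans cY nBM) Aw Aw' ww').
- by move=> e x ej xS; rewrite base_actE ej.
- by move=> e x ej xS _; rewrite base_actE (negbTE ej).
by move=> l x lj _ _; apply: base_orb.
Qed.
End FirstPiece.

(** [W] traces a walk from [x0] entering the last piece at its identity. By [ch_free] its earlier
    vertices are outside the free part, so gluing there leaves the walk intact. *)
Record chain (X : finType) (a : E -> {perm X}) (j : I) (iota : D -> X)
    (Dd : {set D}) (m : nat) (x0 : X) (W : seq E) : Prop := {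
  ch_tail : tail_piece a j iota Dd m;
  ch_end : ev a W x0 = iota 1;
  ch_free : forall W1 e W2 x, W = W1 ++ e :: W2 -> x \in Dside j ->
    x \notin Dd -> iota x <> ev a W1 x0 }.

Section ChainStep.
Variables (X : finType) (a : E -> {perm X}) (j : I) (iota : D -> X).
Variables (Dd : {set D}) (m : nat) (x0 : X) (W w : seq E).
Hypothesis ch : chain a j iota Dd m x0 W.
Hypothesis wj : all (at1 j) w.

Lemma chain_endE : ev a (W ++ w) x0 = iota (ev d w).
Proof.
have tp := ch_tail ch.
rewrite ev_perm_cat (ch_end ch) -[in RHS](mul1g (ev d w)).
elim: w wj 1 (group1 (Dside j)) => [|e u IH] /=.
  by move=> _ x; rewrite ev_perm_nil ev_nil mulg1.
case/andP=> ej uj x xS; rewrite ev_permM (tp_act tp) // ev_cons mulgA IH //.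
by rewrite groupM // Dside_gen.
Qed.

Variable j' : I.
Hypothesis jj' : j != j'.
Hypothesis h_free : forall b, b \in Dpair j j' -> ev d w * b \notin Dd.
Hypothesis m_gt0 : 0 < m.
Hypothesis mM : m * nB.+1 <= M.

(** The last two conclusions keep track of [x0]: the second piece can contain it only in the overlap
    with the first, and the pieces from the third on miss it. *)
Lemma chain_step : exists a' : E -> {perm X + D}, exists iota',
  [/\ chain a' j' iota' (Dpair j j') (m * nB.+1) (inl x0) (W ++ w),
      forall x, x \in Dside j' -> x \notin Dpair j j' -> iota' x <> inl x0
    & (forall x, x \in Dside j -> x \notin Dd -> iota x <> x0) ->
      forall x, x \in Dside j' -> iota' x <> inl x0].
Proof.
have tp := ch_tail ch.
have hj : ev d w \in Dside j by apply/DsideP; exists w.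
pose g := glue tp hj h_free.
exists g, (kappa j iota (ev d w) j').
(* Gluing affects only letters at [j'] read in the glued coset. The walk is not there before the end
   of [W], and the letters of [w] are at [j], where the old and the new action agree. *)
have gE W1 W2 : W ++ w = W1 ++ W2 -> ev g W1 (inl x0) = inl (ev a W1 x0).
  elim/last_ind: W1 W2 => [|W1 e IH] W2; first by rewrite !ev_perm_nil.
  rewrite cat_rcons => EW; rewrite -cats1 !ev_perm_cat (IH _ EW).
  rewrite !ev_permM !ev_perm_nil permE.
  case: (boolP (onK j iota (ev d w) j' (inl (ev a W1 x0)))) => [|zK]; last first.
    by rewrite /= glue_old.
  case: (boolP (inc e j')) => ej'; last by rewrite glue_ninc.
  case/onK_inl=> b bF Eb.
  have ej : inc e j.
    have [sW|sW] := ltnP (size W1) (size W).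
      have EW' : W = W1 ++ e :: drop (size W1).+1 W.
        
        have : drop (size W1) W = e :: drop (size W1).+1 W.
          rewrite (drop_nth e sW); congr (_ :: _).
          have := congr1 (nth e ^~ (size W1)) EW.
          by rewrite !nth_cat sW ltnn subnn.
        move=> <-; rewrite -[LHS](cat_take_drop (size W1)); congr (_ ++ _).
        have := congr1 (take (size W1)) EW.
        by rewrite take_cat sW take_size_cat.
      case: (ch_free ch EW' (hF0 hj bF) (h_free bF)).
      by rewrite -Eb.
    have ew : e \in w.
      move/eqP: EW; rewrite -{1}(cat_take_drop (size W) W1) -catA.
      rewrite eqseq_cat ?size_takel // => /andP[_ /eqP->].
      by rewrite mem_cat inE eqxx orbT.
    by have /allP/(_ e ew) := wj.
  rewrite Eb; have -> : inl (iota (ev d w * b)) = kappa j iota (ev d w) j' b.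
    by rewrite /kappa bF.
  rewrite (glue_kappa tp hj ej' (F0j' bF)).
  by rewrite /kappa groupMl // Dpair_gen // (old_iota tp hj h_free ej' bF) ej.
split.
- split; first exact: glue_tail.
    by rewrite (gE _ [::]) ?cats0 // chain_endE /kappa group1 mulg1.
  move=> W1 e W2 x EW xS xF; rewrite (gE _ _ EW).
  by rewrite /kappa (negbTE xF).
- by move=> x xS xF; rewrite /kappa (negbTE xF).
move=> x0F x xS; rewrite /kappa; case: ifP => // xF [].
apply: x0F (h_free xF); apply: groupM; [exact: hj | exact: F0j xF].
Qed.
End ChainStep.

(** [p] is the colour of the previous piece. The middle condition says that the overlaps with the
    previous and the next piece are disjoint, so that the next one attaches to the free part. *)
Fixpoint good_chain (p : I) (q : I * seq E) (L : seq (I * seq E)) : Prop :=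
  all (at1 q.1) q.2 /\
  if L is r :: L' then
    [/\ q.1 != r.1,
        forall b, b \in Dpair q.1 r.1 -> ev d q.2 * b \notin Dpair p q.1
      & good_chain q.1 r L']
  else True.

Definition chain_word (L : seq (I * seq E)) : seq E := flatten [seq q.2 | q <- L].

(** The remaining pieces are glued one by one; the walk ends in the last piece, which misses the
    start. Each gluing costs a factor [nB.+1] in the orbit bound and [#|D|] points. *)
Lemma chain_rec (L : seq (I * seq E)) p q (X : finType) (a : E -> {perm X})
    iota m x0 W :
    chain a q.1 iota (Dpair p q.1) m x0 W ->
    (forall x, x \in Dside q.1 -> iota x <> x0) ->
    0 < m -> m * nB.+1 ^ size L <= M -> good_chain p q L ->
  exists (X' : finType) (a' : E -> {perm X'}) (x0' : X'),
    [/\ side_compat a', #|X'| = (#|X| + size L * #|D|)%N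
      & ev a' (W ++ chain_word (q :: L)) x0' <> x0'].
Proof.
elim: L p q X a iota m x0 W => [|r L IH] p q X a iota m x0 W ch x0F m0 mM /=.
  case=> Aq _; exists X, a, x0; split.
  - exact: tp_compat (ch_tail ch).
  - by rewrite addn0.
  rewrite /chain_word /= cats0 (chain_endE ch) //.
  by apply: x0F; apply/DsideP; exists q.2.
case=> Aq [qr qfree gL].
have mM' : m * nB.+1 <= M.
  apply: leq_trans mM; rewrite leq_pmul2l //= expnS leq_pmulr //.
  by rewrite expn_gt0.
have [a' [iota' [ch' _ x0F']]] := chain_step ch Aq qr qfree m0 mM'.
have {}x0F' x : x \in Dside r.1 -> iota' x <> inl x0.
  by apply: x0F' => y yS _; apply: x0F.
have [||X' [a2 [x2 [cX' cardX' E2]]]] := IH _ _ _ _ _ _ _ _ ch' x0F' _ _ gL.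
- by rewrite muln_gt0 m0.
- by rewrite -mulnA -expnS.
exists X', a2, x2; split=> //.
  by rewrite cardX' card_sum mulSn addnA.
by move: E2; rewrite /chain_word /= !catA.
Qed.

Lemma first_chain j : nB <= M -> chain (base_act j) j id set0 nB 1 [::].
Proof.
move=> nBM; split; first exact: base_tail.
  by rewrite ev_perm_nil.
by move=> [].
Qed.

(** With two pieces the walk starts in the first and ends in the second outside their overlap. *)
Lemma detect2 i j u w : 0 < nB -> nB * nB.+1 <= M -> i != j ->
    all (at1 i) u -> all (at1 j) w -> ev d w \notin Dpair i j ->
  exists (X : finType) (a : E -> {perm X}) (x0 : X),
    [/\ side_compat a, #|X| = (2 * #|D|)%N & ev a (u ++ w) x0 <> x0].
Proof.
move=> nB0 nBM ij Au Aw wF.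
have nBM' : nB <= M by apply: leq_trans nBM; rewrite leq_pmulr.
have [|a [iota [ch x0F _]]] := chain_step (first_chain i nBM') Au ij _ nB0 nBM.
  by move=> b _; rewrite inE.
exists (D + D)%type, a, (inl 1); split.
- exact: tp_compat (ch_tail ch).
- by rewrite card_sum mul2n addnn.
rewrite (chain_endE ch Aw); apply: x0F => //.
by apply/DsideP; exists w.
Qed.

(** Two gluings precede [chain_rec], because only the third piece is certain to miss [x0]. *)
Lemma detect_chain p q r L : 0 < nB -> nB * nB.+1 ^ (size L).+2 <= M ->
    all (at1 p.1) p.2 -> p.1 != q.1 -> good_chain p.1 q (r :: L) ->
  exists (X : finType) (a : E -> {perm X}) (x0 : X),
    [/\ side_compat a, #|X| = ((size L).+3 * #|D|)%N
      & ev a (chain_word [:: p, q, r & L]) x0 <> x0].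
Proof.
move=> nB0 nBM Ap pq /= [Aq [qr qfree gL]].
have nBM2 : nB * nB.+1 * nB.+1 <= M.
  apply: leq_trans nBM; rewrite -mulnA leq_pmul2l // !expnS mulnA leq_pmulr //.
  by rewrite expn_gt0.
have nBM1 : nB * nB.+1 <= M by apply: leq_trans nBM2; rewrite leq_pmulr.
have nBM0 : nB <= M by apply: leq_trans nBM1; rewrite leq_pmulr.
have [|a [iota [ch x0F _]]] := chain_step (first_chain p.1 nBM0) Ap pq _ nB0 nBM1.
  by move=> b _; rewrite inE.
have m0 : 0 < nB * nB.+1 by rewrite muln_gt0 nB0.
have [a' [iota' [ch' _ x0F']]] := chain_step ch Aq qr qfree m0 nBM2.
have [||X [a2 [x2 [cX cardX E2]]]] := chain_rec ch' (x0F' x0F) _ _ gL.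
- by rewrite muln_gt0 m0.
- by rewrite -2!mulnA -!expnS.
exists X, a2, x2; split=> //.
  by rewrite cardX !card_sum !mulSn !addnA.
by move: E2; rewrite /chain_word /= !catA.
Qed.
End Gluing.

(** * Acyclic groups *)

Section AcyclicGroup.
Variables (E I : finType) (inc : E -> pred I).
Hypothesis inc2 : forall e i j l,
  inc e i -> inc e j -> inc e l -> [|| i == j, i == l | j == l].
Variables (B : finGroupType) (v : E -> B) (N : nat).

(** The second clause excludes triangles of pair subgroups inside one side. The third says that a
    short closed chain of cosets has three consecutive ones with a common point; the first and last
    colours of [K] may agree, so only inner factors are tested. *)
Definition acyclic_group (gT : finGroupType) (s : E -> gT) : Prop :=
  [/\ forall i j g, i != j -> g \in Dside inc s i -> g \in Dside inc s j ->
        g \in Dpair inc s i j,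
      forall i j l m a b c, i != j -> i != l -> i != m -> j != l -> j != m ->
        a \in Dpair inc s i j -> b \in Dpair inc s i l -> c \in Dpair inc s i m ->
        a * b * c = 1 -> a = 1
    & forall K : seq (I * gT), 2 < size K <= N ->
        all (fun x => x.2 \in Dside inc s x.1) K ->
        sorted (fun x y => x.1 != y.1) K -> \prod_(x <- K) x.2 = 1 ->
        exists L1 x y z L2 a b, [/\ K = L1 ++ [:: x, y, z & L2],
          a \in Dpair inc s x.1 y.1, b \in Dpair inc s y.1 z.1 & y.2 = a * b]].

Section Upper.
Variables (D : finGroupType) (d : E -> D) (M nB : nat).
Hypothesis nB_gt0 : 0 < nB.
Hypothesis nB_M : forall k, k <= N.+2 -> nB * nB.+1 ^ k <= M.
Hypothesis d_pair : forall i j, i != j -> factors (at2 inc i j) v d.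
Hypothesis d_card : forall i j, i != j -> #|Dpair inc d i j| <= nB.
Hypothesis d_triv : forall i j l g, i != j -> i != l -> j != l ->
  g \in Dpair inc d i j -> g \in Dpair inc d i l -> g = 1.
Hypothesis d_retract : forall i j w w', i != j -> ev d w = ev d w' ->
  ev v (filter (at2 inc i j) w) = ev v (filter (at2 inc i j) w').
Hypothesis d_orb : forall (X : finType) (a : E -> {perm X}) l (Y : {set X}),
    pair_compat inc v a -> closed_at inc a l Y -> #|Y| <= M ->
  forall w w', all (at1 inc l) w -> all (at1 inc l) w' -> ev d w = ev d w' ->
    {in Y, ev a w =1 ev a w'}.

(** Room for glued chains of at most [N] pieces, and for the two pieces of [detect2] even when [N]
    is small. *)
Let MB := (N.+3 * #|D|)%N.
Let sperm := ufact (at1 inc) d MB.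
Let s (e : E) := ((sperm e, d e) : (_ * D)%type).

Let s_d w w' : ev s w = ev s w' -> ev d w = ev d w'.
Proof. by rewrite !ev_pair => -[]. Qed.

Let s_factors l : factors (at1 inc l) d s.
Proof.
move=> w w' Aw Aw' ww'; rewrite !ev_pair ww'; congr (_, _).
exact: (@ufact_factors _ _ _ _ _ _ l).
Qed.

Let s_act (X : finType) (a : E -> {perm X}) w w' :
  #|X| <= MB -> side_compat inc d a -> ev s w = ev s w' -> ev a w = ev a w'.
Proof.
by move=> XM aC; rewrite !ev_pair => -[ww' _]; apply: (ufactP XM aC ww').
Qed.

(** [g] is a word at [i] whose inverse is a word at [j]. Were the latter outside the pair subgroup
    of [d], [detect2] would let the product of both words move a point. *)
Let s_inter i j g : i != j -> g \in Dside inc s i -> g \in Dside inc s j ->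
  g \in Dpair inc s i j.
Proof.
move=> ij /DsideP[u Au ->] gj.
have /DsideP[w Aw Ew] : (ev s u)^-1 \in Dside inc s j by rewrite groupV.
have [|wF] := boolP (ev d w \in Dpair inc d i j).
  case/DpairP=> u' Au' ww'.
  rewrite -groupV Ew (s_factors Aw (all_at2r Au') ww').
  by apply/DpairP; exists u'.
have M1 : nB * nB.+1 <= M by have := @nB_M 1 isT; rewrite expn1.
have [X [a [x0 [aC cX E0]]]] :=
  detect2 inc2 d_pair d_card d_triv d_orb nB_gt0 M1 ij Au Aw wF.
case: E0; rewrite (@s_act _ a _ [::] _ aC) ?ev_perm_nil //.
  by rewrite cX leq_mul2r orbC.
by rewrite ev_cat -Ew mulgV ev_nil.
Qed.

Let s_triple i j l m a b c : i != j -> i != l -> i != m -> j != l -> j != m ->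
  a \in Dpair inc s i j -> b \in Dpair inc s i l -> c \in Dpair inc s i m ->
  a * b * c = 1 -> a = 1.
Proof.
move=> ij il im jl jm /DpairP[u Au ->] /DpairP[w Aw ->] /DpairP[x Ax ->].
rewrite -!ev_cat -(ev_nil s) => /s_d/(d_retract ij).
rewrite !filter_cat (all_filterP Au).
rewrite (filter_at2 inc2 ij il Aw) (filter_at2 inc2 ij im Ax).
rewrite !inE !xpair_eqE eqxx (negbTE il) (negbTE jl) (negbTE im) (negbTE jm) /=.
rewrite !cats0 => vu; apply: (s_factors (all_at2l Au)) => //.
by apply: (d_pair ij).
Qed.

Let words_of (K : seq (I * _)) : all (fun x => x.2 \in Dside inc s x.1) K ->
  exists2 W : seq (I * seq E), all (fun q => all (at1 inc q.1) q.2) W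
    & K = [seq (q.1, ev s q.2) | q <- W].
Proof.
elim: K => [|[i g] K IH] /=; first by exists [::].
case/andP=> /DsideP[w Aw ->] /IH[W AW ->].
by exists ((i, w) :: W); rewrite //= Aw.
Qed.

(** A failing overlap condition factors [ev d q.2] into elements of two pair subgroups; all words
    involved are at the colour [q.1], so [s_factors] lifts the factorisation to [s]. *)
Let good_or_degenerate (L : seq (I * seq E)) p q :
    all (fun q => all (at1 inc q.1) q.2) [:: p, q & L] ->
    sorted (fun x y => x.1 != y.1) [:: p, q & L] ->
  good_chain inc d p.1 q L \/
  exists L1 x y z L2 a b, [/\ [:: p, q & L] = L1 ++ [:: x, y, z & L2],
    a \in Dpair inc s x.1 y.1, b \in Dpair inc s y.1 z.1 & ev s y.2 = a * b].
Proof.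
elim: L p q => [|r L IH] p q /and3P[Ap Aq AL]; first by left.
move=> /and3P[pq qr sL].
have [/existsP[b /andP[bF baF]]|H] :=
    boolP [exists b in Dpair inc d q.1 r.1, ev d q.2 * b \in Dpair inc d p.1 q.1].
  right; have /DpairP[u Au Eu] := baF.
  have /DpairP[u' Au' Eu'] : b^-1 \in Dpair inc d q.1 r.1 by rewrite groupV.
  exists [::], p, q, r, L, (ev s u), (ev s u').
  split=> //; first by apply/DpairP; exists u.
    by apply/DpairP; exists u'.
  rewrite -ev_cat; apply: (s_factors Aq).
    by rewrite all_cat (all_at2r Au) (all_at2l Au').
  by rewrite ev_cat -Eu -Eu' mulgK.
have [||gL|] := IH q r.
- by rewrite /= Aq.
- by rewrite /= qr.
- left; split=> //; split=> // b bF; apply: contraNN H => baF.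
  by apply/existsP; exists b; rewrite bF.
case=> L1 [x [y [z [L2 [a [b [E0 aF bF Ey]]]]]]]; right.
by exists (p :: L1), x, y, z, L2, a, b; rewrite E0.
Qed.

Let s_chain (K : seq (I * _)) : 2 < size K <= N ->
    all (fun x => x.2 \in Dside inc s x.1) K ->
    sorted (fun x y => x.1 != y.1) K -> \prod_(x <- K) x.2 = 1 ->
  exists L1 x y z L2 a b, [/\ K = L1 ++ [:: x, y, z & L2],
    a \in Dpair inc s x.1 y.1, b \in Dpair inc s y.1 z.1 & y.2 = a * b].
Proof.
move=> K3N /words_of[W AW EK]; rewrite EK sorted_map => sW.
rewrite big_map => W1; rewrite {}EK size_map in K3N.
have {W1} W1 : ev s (chain_word W) = 1.
  rewrite -{}W1 /chain_word; elim: W {K3N AW sW} => [|q W IH] /=.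
    by rewrite big_nil ev_nil.
  by rewrite big_cons ev_cat IH.
case: W AW sW W1 K3N => [|p [|q [|r L]]] // AW sW W1 /andP[_ KN].
have [gL|[L1 [x [y [z [L2 [a [b [E0 aF bF Ey]]]]]]]]] := good_or_degenerate AW sW.
  have ML : nB * nB.+1 ^ (size L).+2 <= M.
    by apply/nB_M/leqW/leqW/ltnW.
  have [Ap pq] : all (at1 inc p.1) p.2 /\ p.1 != q.1.
    by case/andP: AW => ->; case/andP: sW.
  have [X [a [x0 [aC cX E0]]]] :=
    detect_chain inc2 d_pair d_card d_triv d_orb nB_gt0 ML Ap pq gL.
  case: E0; rewrite (@s_act _ a _ [::] _ aC) ?ev_perm_nil ?W1 ?ev_nil //.
  by rewrite cX leq_mul2r; apply/orP; right; do 3![apply: leqW].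
pose f (q : I * seq E) := (q.1, ev s q.2).
by exists (map f L1), (f x), (f y), (f z), (map f L2), a, b; rewrite E0 map_cat.
Qed.

Lemma acyclic_group_upper : exists (gT : finGroupType) (t : E -> gT) (pi : gT -> D),
  [/\ forall x y, pi (x * y) = pi x * pi y, forall e, pi (t e) = d e
    & acyclic_group t].
Proof. by exists _, s, snd; split=> //; split. Qed.
End Upper.

Lemma acyclic_group_exists : exists (gT : finGroupType) (t : E -> gT) (pi : gT -> B),
  [/\ forall x y, pi (x * y) = pi x * pi y, forall e, pi (t e) = v e
    & acyclic_group t].
Proof.
have nB_gt0 : 0 < #|B| by apply/card_gt0P; exists 1.
(* [M] must dominate the orbit bounds of all chains that are glued at the second level. *)
have [M nB_M] : exists M, forall k, k <= N.+2 -> #|B| * #|B|.+1 ^ k <= M.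
  by exists (#|B| * #|B|.+1 ^ N.+2)%N => k kN; rewrite leq_pmul2l // leq_pexp2l.
have BM : #|B| <= M by apply: leq_trans (nB_M 0 isT); rewrite muln1.
have d_orb (X : finType) (a : E -> {perm X}) l (Y : {set X}) :
    pair_compat inc v a -> closed_at inc a l Y -> #|Y| <= M ->
    forall w w', all (at1 inc l) w -> all (at1 inc l) w' ->
    ev (dgen inc v M) w = ev (dgen inc v M) w' -> {in Y, ev a w =1 ev a w'}.
  move=> aC /forall_inP clY YM; apply: (orbit_factors inc2 aC YM).
  by move=> e x el /clY/forallP/(_ e)/implyP; apply.
have [gT [t [pi [piM piE tA]]]] :=
  acyclic_group_upper nB_gt0 nB_M
    (@dgen_factors _ _ inc _ v M) (@card_Dpair _ _ inc _ v M)
    (fun i j l g => @Dpair_trivI _ _ _ inc2 _ v M i j l g BM)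
    (fun i j w w' ij => @retract _ _ _ inc2 _ v M i j ij BM w w') d_orb.
exists gT, t, (fun g => (pi g).2); split=> //.
  by move=> x y; rewrite piM.
by move=> e; rewrite piE.
Qed.
End AcyclicGroup.

(** * 3-connected families of cosets *)

Definition avoid (V : finType) (k : rel V) (A : {set V}) : rel V :=
  fun x y => [&& k x y, x \notin A & y \notin A].

Definition conn3 (V : finType) (k : rel V) : Prop :=
  3 < #|V| /\ forall A : {set V}, #|A| <= 2 ->
    forall x y, x \notin A -> y \notin A -> connect (avoid k A) x y.

Lemma avoid_path (V : finType) (k : rel V) (A : {set V}) x y :
    x \notin A -> connect (avoid k A) x y ->
  exists p, [/\ path k x p, last x p = y, uniq (x :: p),
    all (fun z => z \notin A) (x :: p) & all (connect (avoid k A) x) (x :: p)].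
Proof.
move=> xA /connectP[p0 p0P ->]; case/shortenP: p0P => p pP pU _.
exists p; split=> //.
- by apply: sub_path pP => u v /and3P[].
- rewrite /= xA /=; elim: p x xA pP {pU} => //= u p IH x xA /andP[/and3P[_ _ uA]].
  by rewrite uA; apply: IH.
by apply/allP; apply: path_connect pP.
Qed.

Section CosetIntersection.
Variables (E I : finType) (inc : E -> pred I) (gT : finGroupType) (s : E -> gT).
Variable N : nat.
Hypothesis sA : acyclic_group inc N s.
Local Notation S := (Dside inc s).
Local Notation P := (Dpair inc s).

Variables (V : finType) (col : V -> I) (g : V -> gT).
Hypothesis VN : #|V| <= N.

Definition coset_at (u : V) : {set gT} := g u *: S (col u).
Local Notation X := coset_at.

Definition meet (u w : V) := [exists x, (x \in X u) && (x \in X w)].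

Hypothesis meet_col : forall u w, u != w -> meet u w -> col u != col w.

Lemma meetP u w : reflect (exists x, x \in X u /\ x \in X w) (meet u w).
Proof.
apply: (iffP existsP) => -[x]; first by case/andP=> xu xw; exists x.
by case=> xu xw; exists x; rewrite xu xw.
Qed.

Lemma meetC u w : meet u w = meet w u.
Proof. by apply/meetP/meetP => -[x []]; exists x. Qed.

Lemma coset_quot u x y : x \in X u -> y \in X u -> x^-1 * y \in S (col u).
Proof.
rewrite !mem_lcoset => xX yX.
by rewrite -(mulKVg (g u) y) mulgA -{1}(invgK (g u)) -invMg groupM ?groupV.
Qed.

Lemma coset_mul u x h : x \in X u -> h \in S (col u) -> x * h \in X u.
Proof. by rewrite !mem_lcoset => xX hS; rewrite mulgA groupM. Qed.

Lemma P_l i j x : x \in P i j -> x \in S i.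
Proof. exact: subsetP (Dpair_sub inc s i j) x. Qed.

Lemma P_r i j x : x \in P i j -> x \in S j.
Proof. by rewrite DpairC; apply: P_l. Qed.

Definition pt u w : gT := odflt 1 [pick x | (x \in X u) && (x \in X w)].

Lemma ptP u w : meet u w -> pt u w \in X u /\ pt u w \in X w.
Proof.
rewrite /pt => /meetP[x [xu xw]]; case: pickP => [y /andP[]|/(_ x)] //=.
by rewrite xu xw.
Qed.

(** The moves from [y] to [fin] through chosen points of consecutive intersections, each labelled by
    the colour of the coset it stays in; for [fin = y] their product is [1]. *)
Fixpoint steps (y fin : gT) (u : V) (r : seq V) : seq (I * gT) :=
  if r is w :: r' then (col u, y^-1 * pt u w) :: steps (pt u w) fin w r'
  else [:: (col u, y^-1 * fin)].

Lemma size_steps y fin u r : size (steps y fin u r) = (size r).+1.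
Proof. by elim: r y u => //= w r IH y u; rewrite IH. Qed.

Lemma prod_steps y fin u r : \prod_(x <- steps y fin u r) x.2 = y^-1 * fin.
Proof.
elim: r y u => [|w r IH] y u /=; first by rewrite big_seq1.
by rewrite big_cons IH /= -!mulgA mulKVg.
Qed.

Lemma all_steps y fin u r : y \in X u -> fin \in X (last u r) -> path meet u r ->
  all (fun x => x.2 \in S x.1) (steps y fin u r).
Proof.
elim: r y u => [|w r IH] y u /= yu fX; first by rewrite coset_quot.
by case/andP=> /ptP[pu pw] rP; rewrite coset_quot //= IH.
Qed.

Lemma sorted_steps y fin u r : path meet u r -> uniq (u :: r) ->
  sorted (fun x y => x.1 != y.1) (steps y fin u r).
Proof.
elim: r y u => [|w r IH] y u //= /andP[uw rP] /and3P[].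
rewrite inE negb_or => /andP[uw' _] wr rU.
have := IH (pt u w) w rP; rewrite /= wr => /(_ rU).
have uw2 := meet_col uw' uw.
by case: r {IH rP wr rU} => [|w' r] /=; rewrite uw2.
Qed.

(** If the move inside the second coset factors as [a * b], then the entry point times [a] lies in
    all three cosets. *)
Lemma split_steps y fin u r L1 x1 x2 x3 L2 a b :
    path meet u r -> fin \in X (last u r) -> steps y fin u r = L1 ++ [:: x1, x2, x3 & L2] ->
    a \in P x1.1 x2.1 -> b \in P x2.1 x3.1 -> x2.2 = a * b ->
  exists V1 v1 v2 v3 V2 t, [/\ u :: r = V1 ++ [:: v1, v2, v3 & V2],
    t \in X v1, t \in X v2 & t \in X v3].
Proof.
elim: L1 y u r => [|x0 L1 IH] y u r rP fX /=.
  case: r rP fX => [|w [|w' r]] //= /and3P[/ptP[pu pw] /ptP[qw qw'] _] _.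
  case=> <- <- E3 /= aP.
  have -> : x3.1 = col w' by case: r E3 => [|? ?] /= [<- _].
  move=> bP Eab.
  exists [::], u, w, w', r, (pt u w * a); split=> //.
  - by apply: coset_mul => //; apply: P_l aP.
  - by apply: coset_mul => //; apply: P_r aP.
  have -> : pt u w * a = pt w w' * b^-1.
    by apply: (mulIg b); rewrite -mulgA -Eab mulKVg mulgKV.
  by apply: coset_mul => //; rewrite groupV; apply: P_r bP.
case: r rP fX => [|w r] /=; first by case: L1 {IH}.
case/andP=> _ rP fX [_ Es] aP bP Eab.
have [V1 [v1 [v2 [v3 [V2 [t [EV t1 t2 t3]]]]]]] := IH _ _ _ rP fX Es aP bP Eab.
by exists (u :: V1), v1, v2, v3, V2, t; rewrite EV.
Qed.

Lemma sorted_skip (T : Type) (e : rel T) V1 (v1 v2 v3 : T) V2 :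
  sorted e (V1 ++ [:: v1, v2, v3 & V2]) -> e v1 v3 ->
  sorted e (V1 ++ [:: v1, v3 & V2]).
Proof.
move=> + e13; elim: V1 => [|a V1 IH] /=; first by case/and3P=> _ _ ->; rewrite e13.
by case: V1 IH => [|b V1] /= IH /andP[->] /IH.
Qed.

(* A closed walk of cosets that does not collapse contains an inner coset
   meeting both of its neighbours in one point; delete it and iterate. *)
Lemma walk_triple u r : 1 < size r -> uniq (u :: r) -> path meet u r ->
    meet u (last u r) ->
  exists w t, [/\ w \in r, w != last u r, t \in X u, t \in X w & t \in X (last u r)].
Proof.
have [n] := ubnP (size r); elim: n r => // n IH r rn r1 rU rP ur.
have [pu pl] := ptP ur; set y := pt _ _ in pu pl.
have [_ _ A3] := sA.
have [||||L1 [x1 [x2 [x3 [L2 [a [b [EK aP bP Eab]]]]]]]] := A3 (steps y y u r).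
- rewrite size_steps ltnS r1; apply: leq_trans VN.
  by rewrite -[(size r).+1]/(size (u :: r)) -(card_uniqP rU) max_card.
- exact: all_steps.
- exact: sorted_steps.
- by rewrite prod_steps mulVg.
have [V1 [v1 [v2 [v3 [V2 [t [EV t1 t2 t3]]]]]]] := split_steps rP pl EK aP bP Eab.
have v13 : meet v1 v3 by apply/meetP; exists t.
have EU : uniq (V1 ++ [:: v1, v2, v3 & V2]) by rewrite -EV.
have ES : sorted meet (V1 ++ [:: v1, v3 & V2]).
  by apply: (sorted_skip (v2 := v2)) v13; rewrite -EV.
have sub : subseq (V1 ++ [:: v1, v3 & V2]) (V1 ++ [:: v1, v2, v3 & V2]).
  apply: cat_subseq => //.
  by apply: (@cat_subseq _ [:: v1] _ [:: v1; v2]); rewrite //= eqxx.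
have {sub} EU' := subseq_uniq sub EU.
have lE : last u r = last v3 V2.
  by rewrite -[last u r]/(last u (u :: r)) EV last_cat.
case: V1 EV ES EU EU' => [[Eu Er]|u' V1 [Eu Er]] /= ES EU EU'; subst u.
  (* The triple starts the walk: either it is the whole walk and its middle coset is the witness, or
     the middle coset is dropped. *)
  have [V20|V20] := posnP (size V2).
    move: V20 lE Er => /size0nil -> /= lE Er; exists v2, t; rewrite lE Er.
    split=> //; first by rewrite inE eqxx.
    by case/and3P: EU => _; rewrite inE negb_or => /andP[->].
  have [|||w [t' [wr wl tu tw tl]]] := IH (v3 :: V2) _ _ EU' ES _.
  - by move: rn; rewrite Er /=.
  - by [].
  - by rewrite /= -lE.
  exists w, t'; rewrite lE; split=> //.
  by rewrite Er in_cons wr orbT.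
have [|||w [t' [wr wl tu tw tl]]] := IH (V1 ++ [:: v1, v3 & V2]) _ _ EU' ES _.
- move: rn; rewrite Er !size_cat /= !addnS ltnS; exact.
- by rewrite size_cat /= !addnS.
- by rewrite last_cat /= -lE.
move: wl tl; rewrite last_cat /= => wl tl.
exists w, t'; rewrite lE; split=> //.
by rewrite Er; move: wr; rewrite !mem_cat !inE => /or3P[->|->|->]; rewrite ?orbT.
Qed.

Variable k : rel V.
Hypothesis k_sym : symmetric k.
Hypothesis k_irr : irreflexive k.
Hypothesis k_meet : forall u w, k u w -> meet u w.
Hypothesis k_conn : conn3 k.

Lemma conn3_nbr z (A : {set V}) : #|A| <= 2 -> z \notin A ->
  exists2 c, k z c & c \notin A.
Proof.
move=> A2 zA; have [V4 kA] := k_conn.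
have /subsetPn[y _] : ~~ ([set: V] \subset z |: A).
  apply: contraL V4 => /subset_leq_card; rewrite cardsT cardsU1 zA -leqNgt.
  by move/leq_trans; apply.
rewrite !inE negb_or => /andP[yz yA].
have /connectP[[|c p] /= cP Ey] := kA A A2 z y zA yA.
  by rewrite Ey eqxx in yz.
by case/andP: cP => /and3P[zc _ cA] _; exists c.
Qed.

Lemma walk_through a p z z' : path k a p -> uniq (a :: p) ->
    meet z a -> meet (last a p) z' -> z != z' -> z \notin a :: p ->
    z' \notin a :: p -> meet z z' ->
  exists w t, [/\ w \in a :: p, t \in X z, t \in X w & t \in X z'].
Proof.
move=> pP pU za pz' zz' zp z'p mzz'.
have [||||w [t [wr wl tz tw tl]]] := @walk_triple z (rcons (a :: p) z').
- by rewrite size_rcons.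
- by rewrite cons_uniq mem_rcons inE negb_or zz' zp rcons_uniq z'p.
- rewrite rcons_path /= za pz' andbT; apply: sub_path pP; exact: k_meet.
- by rewrite last_rcons.
move: wr wl tl; rewrite last_rcons mem_rcons inE => /orP[->//|wr] _ tl.
by exists w, t.
Qed.

(** Cutting the path at its first coset meeting [z'] forces the coset that [walk_through] returns to
    be the last one. *)
Lemma first_meeting z' p w : path k w p -> uniq (w :: p) -> meet (last w p) z' ->
  exists q, [/\ path k w q, uniq (w :: q), {subset q <= p}, meet (last w q) z'
    & forall y, y \in w :: q -> meet y z' -> y = last w q].
Proof.
elim: p w => [|b p IH] w.
  move=> _ _ wz'; exists [::]; split=> //.
  by move=> y; rewrite inE => /eqP.
have [wz' _ _ _|wz' /= /andP[wb bP] /andP[wbp bU] lz'] := boolP (meet w z').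
  exists [::]; split=> //.
  by move=> y; rewrite inE => /eqP.
have [q [qP qU qp qz' qlast]] := IH b bP bU lz'.
have qbp : {subset b :: q <= b :: p}.
  by move=> y; rewrite !inE => /orP[->//|/qp->]; rewrite orbT.
exists (b :: q); split=> //=.
- by rewrite wb.
- by move: qU => /= ->; rewrite andbT; apply: contra wbp; apply: qbp.
move=> y; rewrite inE => /orP[/eqP-> /=|]; first by rewrite (negbTE wz').
exact: qlast.
Qed.

(** Two adjacent cosets and a path avoiding both, from a neighbour of one to a neighbour of the
    other, form a closed walk for [walk_through]. *)
Lemma triple_point : exists x, 2 < #|[set u | x \in X u]|.
Proof.
have [V4 kA] := k_conn.
have /card_gt0P[z _] : 0 < #|V| by apply: leq_trans V4.
have [||z' zz' _] := @conn3_nbr z set0; rewrite ?cards0 ?inE //.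
have znz' : z != z' by apply: contraTneq zz' => ->; rewrite k_irr.
have [||a za] := @conn3_nbr z [set z'].
- by rewrite cards1.
- by rewrite inE.
rewrite inE => az'; have [||c z'c] := @conn3_nbr z' [set z].
- by rewrite cards1.
- by rewrite inE eq_sym.
rewrite inE => cz.
have az : a != z by apply: contraTneq za => ->; rewrite k_irr.
have cz' : c != z' by apply: contraTneq z'c => ->; rewrite k_irr.
pose A := [set z; z'].
have aA : a \notin A by rewrite !inE negb_or az.
have cA : c \notin A by rewrite !inE negb_or cz.
have A2 : #|A| <= 2 by rewrite cards2; case: (_ != _).
have [p [pP pc pU pA _]] := avoid_path aA (kA A A2 a c aA cA).
have notp y : y \in A -> y \notin a :: p.
  by move=> yA; apply/negP => /(allP pA); rewrite yA.
have [|||w [t [wp tz tw tz']]] :=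
  @walk_through a p z z' pP pU (k_meet za) _ znz' _ _ (k_meet zz').
- by rewrite pc k_meet // k_sym.
- by apply: notp; rewrite !inE eqxx.
- by apply: notp; rewrite !inE eqxx orbT.
exists t; apply/card_gt2P; exists z, w, z'; rewrite !inE tz tw tz'; split=> //.
have wA : w \notin A := allP pA w wp.
by move: wA; rewrite !inE negb_or eq_sym => /andP[-> ->]; rewrite eq_sym.
Qed.

(** A Helly property: a component [W] of the cosets missing [x] is attached to three cosets through
    [x]; some [w] in [W] meets all three, and the triangle clause forces [x] into [w]. *)
Lemma common_point : exists x, forall u, x \in X u.
Proof.
have [_ kA] := k_conn.
have [A1 A2 _] := sA.
have [x x3] := triple_point; exists x; set Z := [set u | x \in X u] in x3.
have inZ u : (u \in Z) = (x \in X u) by rewrite inE.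
move=> w0; rewrite -inZ; apply: contraT => w0Z.
pose W := [set w | connect (avoid k Z) w0 w].
have WZ w : w \in W -> w \notin Z.
  rewrite inE => /(avoid_path w0Z)[p [_ <- _ pZ _]].
  by apply: (allP pZ); apply: mem_last.
have avoid_sym : connect_sym (avoid k Z).
  apply: sym_connect_sym => y y'; rewrite /avoid k_sym.
  by congr (_ && _); apply: andbC.
have WW w w' : w \in W -> w' \in W -> connect (avoid k Z) w w'.
  by rewrite !inE => w0w w0w'; apply: connect_trans w0w'; rewrite avoid_sym.
pose T := [set z in Z | [exists w in W, k w z]].
(* Two attachments at most would form a cut between [W] and a member of [Z], which has more than two
   elements. *)
have T3 : 2 < #|T|.
  rewrite ltnNge; apply/negP => T2.
  have /subsetPn[z zZ zT] : ~~ (Z \subset T).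
    by apply: contraTN x3 => /subset_leq_card ZT; rewrite -leqNgt (leq_trans ZT).
  have w0T : w0 \notin T by rewrite inE (negbTE w0Z).
  have /connectP[p pP Ez] := kA T T2 w0 z w0T zT.
  have stay w p' : w \in W -> path (avoid k T) w p' -> last w p' \in W.
    elim: p' w => //= b p' IH w wW /andP[/and3P[wb _ bT] p'P]; apply: IH p'P.
    have bZ : b \notin Z.
      apply: contraNN bT => bZ; rewrite inE bZ; apply/existsP; exists w.
      by rewrite wW.
    rewrite inE; apply: connect_trans (connect1 _); first by move: wW; rewrite inE; apply.
    by rewrite /avoid wb bZ WZ.
  have w0W : w0 \in W by rewrite inE connect0.
  by have := WZ _ (stay _ _ w0W pP); rewrite -Ez zZ.
have nZ w z : w \in W -> z \in Z -> w != z.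
  by move=> /WZ wZ zZ; apply: contraNneq wZ => ->.
have ZX z : z \in Z -> x \in X z by rewrite inZ.
have ZZ z z' : z \in Z -> z' \in Z -> meet z z'.
  by move=> /ZX zx /ZX z'x; apply/meetP; exists x.
have TP z : z \in T -> z \in Z /\ exists2 a, a \in W & k a z.
  by rewrite inE => /andP[-> /existsP[a /andP[aW az]]]; split=> //; exists a.
have Wpath a c : a \in W -> c \in W -> exists p, [/\ path k a p, last a p = c,
    uniq (a :: p) & {subset a :: p <= W}].
  move=> aW cW; have [p [pP pc pU pZ pW]] := avoid_path (WZ _ aW) (WW _ _ aW cW).
  exists p; split=> // y /(allP pW) ay; move: aW; rewrite !inE => aW.
  exact: connect_trans ay.
have offW p z : {subset p <= W} -> z \in Z -> z \notin p.
  by move=> pW zZ; apply/negP => /pW/nZ/(_ zZ); rewrite eqxx.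
have /card_gt2P[z1 [z2 [z3 [[z1T z2T z3T] [z12 z23 z31]]]]] := T3.
have [[z1Z [a1 a1W az1]] [z2Z [a2 a2W az2]]] := (TP _ z1T, TP _ z2T).
have [z3Z [a3 a3W az3]] := TP _ z3T.
(* First [w1] in [W] meeting [z1] and [z2], then the first coset [w] on the way to [z3] that meets
   [z3]; walks from [z1] and [z2] through [w1] to [z3] force [w] to meet [z1] and [z2] as well. *)
have [p [pP pa2 pU pW]] := Wpath _ _ a1W a2W.
have [|||| w1 [t1 [w1p tz1 tw1 tz2]]] :=
  @walk_through a1 p z1 z2 pP pU _ _ z12 _ _ (ZZ _ _ z1Z z2Z).
- by rewrite meetC k_meet.
- by rewrite pa2 k_meet.
- exact: offW.
- exact: offW.
have w1W := pW _ w1p.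
have [q [qP qa3 qU qW]] := Wpath _ _ w1W a3W.
have [|r [rP rU rq rz3 rlast]] := first_meeting (z' := z3) qP qU.
  by rewrite qa3 k_meet.
have rW : {subset w1 :: r <= W}.
  by move=> y; rewrite inE => /predU1P[->//|/rq yq]; apply: qW; rewrite inE yq orbT.
have z13 : z1 != z3 by rewrite eq_sym.
have m1 : meet z1 w1 by apply/meetP; exists t1.
have m2 : meet z2 w1 by apply/meetP; exists t1.
set w := last w1 r in rz3 rlast.
have wW : w \in W by apply/rW/mem_last.
have [|| w' [y13 [w'r yz1 yw yz3]]] :=
    @walk_through w1 r z1 z3 rP rU m1 rz3 z13 _ _ (ZZ _ _ z1Z z3Z).
- exact: offW.
- exact: offW.
have {w'r} Ew' : w' = w by apply: rlast => //; apply/meetP; exists y13.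
have [|| w'' [y23 [w''r uz2 uw uz3]]] :=
    @walk_through w1 r z2 z3 rP rU m2 rz3 z23 _ _ (ZZ _ _ z2Z z3Z).
- exact: offW.
- exact: offW.
have {w''r} Ew'' : w'' = w by apply: rlast => //; apply/meetP; exists y23.
subst w' w''.
have m1w : meet z1 w by apply/meetP; exists y13.
have m2w : meet w z2 by apply/meetP; exists y23.
have wsub : {subset [:: w] <= W} by move=> y; rewrite inE => /eqP->.
have [|| w' [y12 [+ sz1 sw sz2]]] :=
    @walk_through w [::] z1 z2 isT isT m1w m2w z12 _ _ (ZZ _ _ z1Z z2Z).
- exact: offW.
- exact: offW.
rewrite inE => /eqP Ew'; subst w'.
have [[x1 x2] x3'] := (ZX _ z1Z, ZX _ z2Z, ZX _ z3Z).
have c12 := meet_col z12 (ZZ _ _ z1Z z2Z).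
have c13 := meet_col z13 (ZZ _ _ z1Z z3Z).
have c23 := meet_col z23 (ZZ _ _ z2Z z3Z).
have c1w : col z1 != col w by apply: meet_col m1w; rewrite eq_sym nZ.
have c2w : col z2 != col w by rewrite eq_sym; apply: meet_col m2w; rewrite nZ.
(* Inside the coset [z1] the points [x], [y12], [y13] form a triangle with sides in its pair
   subgroups with [z2], [w], [z3]. *)
have /(congr1 (mulg x)) : x^-1 * y12 = 1.
  apply: (A2 (col z1) (col z2) (col w) (col z3) _ (y12^-1 * y13) (y13^-1 * x)) => //.
  - by apply: A1 => //; apply: coset_quot.
  - by apply: A1 => //; apply: coset_quot.
  - by apply: A1 => //; apply: coset_quot.
  by rewrite -!mulgA !mulKVg mulVg.
rewrite mulKVg mulg1 => Exy; rewrite Exy in sw.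
by have := WZ _ wW; rewrite inZ sw.
Qed.

End CosetIntersection.

(** * The host *)

Section Pattern.
Variables (R : finType) (h : rel R) (u v : R).
Hypothesis h_sym : symmetric h.
Hypothesis uv : u != v.
Local Notation h' := (add_edge h u v).

Definition color : finType := (R * {ffun R -> bool})%type.

(* Colours carry a free bit for every other first coordinate, so each
   [cadj]-edge extends to a full copy of the pattern (see [place]). *)
Definition cadj : rel color :=
  fun i j => (i.1 != j.1) && (i.2 j.1 (+) j.2 i.1).

Lemma cadj_sym : symmetric cadj.
Proof. by move=> i j; rewrite /cadj eq_sym addbC. Qed.

Definition placed (p : {ffun R -> color}) : bool :=
  [forall x, forall y, (x != y) ==>
    ((p x).1 != (p y).1) && (cadj (p x) (p y) == h' x y)].

Lemma placedP (p : {ffun R -> color}) : reflect (forall x y, x != y ->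
    (p x).1 != (p y).1 /\ cadj (p x) (p y) = h' x y) (placed p).
Proof.
apply: (iffP forallP) => [H x y xy|H x].
  by move/forallP/(_ y)/implyP/(_ xy)/andP: (H x) => [-> /eqP].
apply/forallP=> y; apply/implyP=> xy; have [-> ->] := H x y xy.
by rewrite eqxx.
Qed.

Lemma add_edge_sym : symmetric h'.
Proof.
move=> x y; rewrite /add_edge h_sym !inE !xpair_eqE.
rewrite [(x == u) && _]andbC [(x == v) && _]andbC orbC [in RHS]orbC.
by congr (_ || _); rewrite orbC.
Qed.

(** The pattern is ordered with [u], [v] first; each later vertex uses its bits towards the earlier
    ones to get the adjacencies right. *)
Lemma place i j : cadj i j -> exists p : {ffun R -> color},
  [/\ placed p, p u = i & p v = j].
Proof.
case/andP=> ij cij.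
(* The first transposition carries [v] to [w]; the second then carries [w] to [j.1] without moving
   the image of [u]. *)
pose w := tperm u i.1 v.
pose t x := tperm w j.1 (tperm u i.1 x).
have t_inj : injective t by move=> x y /perm_inj/perm_inj.
have tu : t u = i.1.
  rewrite /t tpermL tpermD //; last by rewrite eq_sym.
  by rewrite /w -{2}(tpermL u i.1) (inj_eq perm_inj) eq_sym.
have tv : t v = j.1 by rewrite /t tpermL.
pose rk x : nat := if x == u then 0%N else if x == v then 1%N else (enum_rank x).+2.
have rk_inj : injective rk.
  move=> x y; rewrite /rk.
  case: (x =P u) => [->|_]; case: (y =P u) => [->|_] //.
    by case: ifP.
    by case: ifP.
  case: (x =P v) => [->|_]; case: (y =P v) => [->|_] //.
  by case=> /val_inj/enum_rank_inj.
pose base x : {ffun R -> bool} :=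
  if x == u then i.2 else if x == v then j.2 else [ffun=> false].
pose ti (c : R) := odflt u [pick y | t y == c].
have tiK y : ti (t y) = y.
  by rewrite /ti; case: pickP => [z /eqP/t_inj//|/(_ y)]; rewrite eqxx.
(* A bit towards an earlier vertex compensates for that vertex's own bit; bits of new vertices
   towards later ones are [false]. *)
pose chi x : {ffun R -> bool} :=
  if (x == u) || (x == v) then base x
  else [ffun c => (rk (ti c) < rk x) && (h' x (ti c) (+) base (ti c) (t x))].
have bu : base u = i.2 by rewrite /base eqxx.
have bv : base v = j.2 by rewrite /base eq_sym (negbTE uv) eqxx.
exists [ffun x => (t x, chi x)]; rewrite !ffunE tu tv /chi !eqxx orbT bu bv.
split; [|by case: (i)|by case: (j)].
apply/placedP.
suff H x y : rk y < rk x -> chi x (t y) (+) chi y (t x) = h' x y.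
  move=> x y xy; rewrite !ffunE /cadj /= (inj_eq t_inj) xy; split=> //=.
  have : rk x != rk y by rewrite (inj_eq rk_inj).
  rewrite neq_ltn => /orP[/H|/H <-//].
  by rewrite addbC add_edge_sym.
move=> yx; rewrite {1}/chi; case: ifP => [xuv|xuv].
  have [Ex Ey] : x = v /\ y = u.
    move: yx; rewrite /rk; case/orP: xuv => /eqP->; first by rewrite eqxx.
    by rewrite [v == u]eq_sym (negbTE uv) eqxx; case: eqP => // _; case: ifP.
  rewrite Ex Ey /chi eqxx bv bu tu tv addbC; case/orP: xuv => _;
  by rewrite cij /add_edge !inE eqxx orbT ?orbT.
rewrite ffunE tiK yx /=; case yuv: ((y == u) || (y == v)).
  by rewrite /chi yuv -addbA addbb addbF.
rewrite /chi yuv ffunE tiK ltnNge (ltnW yx) /= addbF.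
by move/negbT: yuv; rewrite negb_or /base => /andP[/negbTE-> /negbTE->]; rewrite ffunE addbF.
Qed.
End Pattern.

Section Host.
Variables (R : finType) (h : rel R) (u v : R) (b : bool) (C : {set R}).
Hypothesis h_sym : symmetric h.
Hypothesis h_irr : irreflexive h.
Hypothesis uv : u != v.
Hypothesis huv : ~~ h u v.
Hypothesis Cc : set_conn3 (twist h b) C.
Hypothesis C_copy : forall k : R -> R, {in C &, injective k} ->
  ~ {in C &, forall x y,
      twist (add_edge h u v) b (k x) (k y) = twist h b x y}.

Local Notation h' := (add_edge h u v).
Local Notation I := (color R).
Definition place_type : finType := {ffun R -> I}.
Local Notation T := place_type.

Definition own (i j : I) : T :=
  odflt [ffun=> (u, [ffun=> false])]
    [pick p : T | [&& placed h u v p, p u == i & p v == j]].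

Lemma ownP i j : cadj i j ->
  [/\ placed h u v (own i j), own i j u = i & own i j v = j].
Proof.
move=> /(place h_sym uv)[p [pP pu pv]]; rewrite /own; case: pickP => [q|/(_ p)].
  by case/and3P=> ? /eqP ? /eqP ?.
by rewrite pP pu pv !eqxx.
Qed.

Definition on (p : T) (i : I) : bool := [exists x, p x == i].

Lemma on_mem p x : on p (p x). Proof. by apply/existsP; exists x. Qed.

Definition letter : finType := (I * I * T)%type.

(** Acts on the types of cells: crossing a colour edge from a copy through it leads to the copy in
    which this edge has the role of [u], [v]. Ill-formed letters act trivially. *)
Definition swap (e : letter) : {perm T} :=
  if [&& cadj e.1.1 e.1.2, placed h u v e.2, on e.2 e.1.1 & on e.2 e.1.2]
  then tperm e.2 (own e.1.1 e.1.2) else 1.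

Definition ends (e : letter) : pred I := fun i => (i == e.1.1) || (i == e.1.2).

Lemma ends2 e i j l : ends e i -> ends e j -> ends e l ->
  [|| i == j, i == l | j == l].
Proof.
by rewrite /ends => /orP[]/eqP-> /orP[]/eqP-> /orP[]/eqP->; rewrite eqxx ?orbT.
Qed.

Lemma swap_placed e p i : ends e i -> placed h u v p -> on p i ->
  placed h u v (swap e p) && on (swap e p) i.
Proof.
rewrite /swap; case: ifP => [/and4P[ce eP e1 e2]|_]; last by rewrite perm1 => _ -> ->.
have [oP oi oj] := ownP ce.
have own_on : ends e i -> on (own e.1.1 e.1.2) i.
  by case/orP=> /eqP->; apply/existsP; [exists u | exists v]; apply/eqP.
have e_on : ends e i -> on e.2 i by case/orP=> /eqP->.
move=> ei pP pi; case: tpermP => [_|_|_ _].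
- by rewrite oP own_on.
- by rewrite eP e_on.
by rewrite pP pi.
Qed.

Variables (gT : finGroupType) (s : letter -> gT) (pi : gT -> {perm T}).
Hypothesis piM : forall x y, pi (x * y) = pi x * pi y.
Hypothesis pi_s : forall e, pi (s e) = swap e.
Hypothesis sA : acyclic_group ends #|R| s.
Variable p0 : T.
Hypothesis p0P : placed h u v p0.

Local Notation S := (Dside ends s).

(** Group elements index the cells of the host; [ty g] is the placement of the pattern carried by
    the cell [g]. *)
Definition ty (g : gT) : T := pi g p0.

Lemma ty1 : ty 1 = p0.
Proof.
have /(congr1 (mulg (pi 1)^-1)) := piM 1 1.
by rewrite mulg1 mulVg mulKg /ty => <-; rewrite perm1.
Qed.

Lemma ty_s g e : ty (g * s e) = swap e (ty g).
Proof. by rewrite /ty piM permM pi_s. Qed.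

Definition cell_has (g : gT) (i : I) : bool := placed h u v (ty g) && on (ty g) i.

Lemma cell_has_mul g x i : x \in S i -> cell_has g i -> cell_has (g * x) i.
Proof.
case/DsideP=> w; elim: w g x => [|e w IH] g x /=.
  by move=> _ ->; rewrite ev_nil mulg1.
case/andP=> ei wi ->; rewrite ev_cons mulgA => /andP[gP gi]; apply: IH => //.
by rewrite /cell_has ty_s swap_placed.
Qed.

(** A coloured coset: all cells in a coset of [S i] share the vertex of colour [i]. *)
Definition host_type : finType := (I * {set gT})%type.
Local Notation X := host_type.

Definition in_cell (x : X) (g : gT) : bool :=
  cell_has g x.1 && (x.2 == g *: S x.1).

Definition near (x y : X) : bool := [exists g, in_cell x g && in_cell y g].

(** The host to start from is [twist sparse b]. In this twisted view only vertices of a common cell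
    can be adjacent, so edges give meeting cosets for both values of [b]. *)
Definition sparse : rel X := fun x y =>
  [&& near x y, x.1.1 != y.1.1 & cadj x.1 y.1 (+) b].

Definition fixed_edge : rel X := fun x y => near x y && cadj x.1 y.1.

Lemma near_sym : symmetric near.
Proof. by move=> x y; apply: eq_existsb => g; apply: andbC. Qed.

Lemma sparse_sym : symmetric sparse.
Proof. by move=> x y; rewrite /sparse near_sym eq_sym cadj_sym. Qed.

Lemma fixed_sym : symmetric fixed_edge.
Proof. by move=> x y; rewrite /fixed_edge near_sym cadj_sym. Qed.

Lemma fixed_sub x y : fixed_edge x y -> twist sparse b x y.
Proof.
case/andP=> nxy cxy; have xy1 : x.1.1 != y.1.1 by case/andP: cxy.
rewrite /twist /sparse nxy xy1 cxy /=.
have -> : x != y by apply: contraNneq xy1 => ->.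
by case: b.
Qed.

Lemma in_cell_mul x g z : z \in S x.1 -> in_cell x g -> in_cell x (g * z).
Proof.
move=> zS /andP[gx /eqP Ex]; rewrite /in_cell cell_has_mul // andTb Ex.
by rewrite lcosetM (lcoset_id zS).
Qed.

Section Cell.
Variable g : gT.
Hypothesis gP : placed h u v (ty g).

Definition cell_vertex (x : R) : X := (ty g x, g *: S (ty g x)).

Lemma cell_vertex_in x : in_cell (cell_vertex x) g.
Proof. by rewrite /in_cell /cell_has gP on_mem /=. Qed.

Lemma cell_near x y : near (cell_vertex x) (cell_vertex y).
Proof. by apply/existsP; exists g; rewrite !cell_vertex_in. Qed.

Lemma cell_inj : injective cell_vertex.
Proof.
move=> x y E0; apply/eqP; apply: contraTT isT => /(placedP _ _ _ _ gP)[].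
by have -> : ty g x = ty g y := congr1 fst E0; rewrite eqxx.
Qed.

Lemma cell_fixed x y : x != y -> fixed_edge (cell_vertex x) (cell_vertex y) = h' x y.
Proof. by move=> xy; rewrite /fixed_edge cell_near; case: (placedP _ _ _ _ gP x y xy). Qed.

Lemma cell_sparse x y : x != y -> sparse (cell_vertex x) (cell_vertex y) = h' x y (+) b.
Proof.
by move=> xy; rewrite /sparse cell_near /=; case: (placedP _ _ _ _ gP x y xy) => -> ->.
Qed.

Lemma cell_twist x y : x != y -> twist sparse b (cell_vertex x) (cell_vertex y) = h' x y.
Proof.
move=> xy; rewrite /twist (inj_eq cell_inj) xy cell_sparse //=.
by rewrite -addbA addbb addbF.
Qed.
End Cell.

(** From a cell containing the edge, the letter for this edge keeps both end vertices and leads to a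
    cell where they sit at [u] and [v]. *)
Lemma fixed_cell x y : fixed_edge x y -> exists g,
  [/\ placed h u v (ty g), cell_vertex g u = x & cell_vertex g v = y].
Proof.
case/andP=> /existsP[g /andP[xg yg]] cxy.
pose e : letter := (x.1, y.1, ty g).
have [ex ey] : ends e x.1 /\ ends e y.1 by rewrite /ends /= !eqxx orbT.
have xe : in_cell x (g * s e) by apply: in_cell_mul => //; apply: Dside_gen.
have ye : in_cell y (g * s e) by apply: in_cell_mul => //; apply: Dside_gen.
have [/andP[/andP[gP gx] _] /andP[/andP[_ gy] _]] := (xg, yg).
have Ety : ty (g * s e) = own x.1 y.1.
  by rewrite ty_s /swap /= cxy gP gx gy /= tpermL.
have [oP ou ov] := ownP cxy.
exists (g * s e); rewrite /cell_vertex Ety ou ov; split=> //.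
- by case/andP: xe => _ /eqP <-; case: (x).
- by case/andP: ye => _ /eqP <-; case: (y).
Qed.

Lemma fixed_exists : exists x y, fixed_edge x y.
Proof.
have gP : placed h u v (ty 1) by rewrite ty1.
exists (cell_vertex 1 u), (cell_vertex 1 v).
by rewrite cell_fixed // /add_edge !inE eqxx orbT.
Qed.

(** Inside the cell whose [u], [v] are the ends of the deleted edge, the two bounds on [c] coincide,
    so [c] is the pattern there. *)
Lemma fixed_delete (c : rel X) x y :
    (forall x y, fixed_edge x y -> c x y) -> (forall x y, c x y -> twist sparse b x y) ->
    fixed_edge x y ->
  exists2 f : R -> X, injective f & forall z w,
    c (f z) (f w) && ([set f z; f w] != [set x; y]) = h z w.
Proof.
move=> Fc cF /fixed_cell[g [gP <- <-]].
exists (cell_vertex g); first exact: cell_inj.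
have cE z w : z != w -> c (cell_vertex g z) (cell_vertex g w) = h' z w.
  move=> zw; apply/idP/idP; first by move/cF; rewrite cell_twist.
  by rewrite -(cell_fixed gP zw); apply: Fc.
move=> z w; have [<-|zw] := eqVneq z w.
  rewrite h_irr; apply/negbTE; rewrite negb_and.
  case: (boolP (c _ _)) => //= /cF; by rewrite /twist eqxx.
rewrite cE //.
have -> : ([set cell_vertex g z; cell_vertex g w] ==
           [set cell_vertex g u; cell_vertex g v]) = ((z, w) \in [:: (u, v); (v, u)]).
  by rewrite eq_set2 !(inj_eq (cell_inj gP)) !inE !xpair_eqE.
have [zwuv|zwuv] := boolP ((z, w) \in _); last by rewrite andbT /add_edge (negbTE zwuv) orbF.
rewrite andbF; apply/esym/negbTE; move: zwuv; rewrite !inE.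
by case/orP=> /eqP[-> ->] //; rewrite h_sym.
Qed.

Let K : finType := {x : R | x \in C}.
Let k : rel K := fun x y => twist h b (val x) (val y).

Let K_conn : conn3 k.
Proof.
have [C4 rC] := set_conn3P _ _ Cc; split; first by rewrite card_sig.
move=> A A2 x y xA yA.
have A'2 : #|val @: A| <= 2 by rewrite card_imset //; apply: val_inj.
have inC z : z \notin A -> val z \in C :\: (val @: A).
  by move=> zA; rewrite inE (valP z) mem_imset ?zA //; apply: val_inj.
have /connectP[p] := rC _ A'2 _ _ (inC _ xA) (inC _ yA).
elim: p x xA => [|z p IH] x xA /=; first by move=> _ /val_inj->; apply: connect0.
case/andP=> /and3P[xz _]; rewrite inE => /andP[zA zC] pP Ey.
pose z' : K := exist (fun x => is_true (x \in C)) z zC.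
have z'A : z' \notin A.
  by apply: contra zA => z'A; apply/imsetP; exists z'.
apply: connect_trans (IH z' z'A pP Ey); apply: connect1.
by rewrite /avoid xA z'A andbT andbT /k.
Qed.

(** The core of a copy of [H] is a 3-connected family of cosets; [common_point] puts it into a
    single cell, that is, into one copy of the pattern, against [C_copy]. *)
Lemma sparse_free (f : R -> X) : injective f ->
  ~ (forall x y, twist sparse b (f x) (f y) = h x y).
Proof.
move=> f_inj fE.
have sE x y : x != y -> sparse (f x) (f y) = twist h b x y.
  move=> xy; have := fE x y; rewrite /twist (inj_eq f_inj) xy /= => <-.
  by rewrite -addbA addbb addbF.
have k_sparse (x y : K) : k x y -> sparse (f (val x)) (f (val y)).
  by move=> kxy; rewrite sE //; case/andP: kxy.
have k_sym : symmetric k by move=> x y; apply: twist_sym.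
have k_irr : irreflexive k by move=> x; rewrite /k /twist eqxx.
pose g (x : K) := odflt 1 [pick g | in_cell (f (val x)) g].
have gP (x : K) : in_cell (f (val x)) (g x).
  have [||y xy _] := @conn3_nbr _ _ K_conn x set0; rewrite ?cards0 ?inE //.
  have /and3P[/existsP[a /andP[xa _]] _ _] := k_sparse _ _ xy.
  by rewrite /g; case: pickP => [//|/(_ a)]; rewrite xa.
pose col (x : K) := (f (val x)).1.
have cosE x : coset_at ends s col g x = (f (val x)).2.
  by have /andP[_ /eqP->] := gP x.
have meet_eq (x y : K) a :
    a \in (f (val x)).2 -> a \in (f (val y)).2 -> col x = col y -> x = y.
  move=> ax ay cxy; apply/val_inj/f_inj; move: ax ay.
  have [/andP[_ /eqP xE] /andP[_ /eqP yE]] := (gP x, gP y).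
  rewrite xE yE -/(col x) -/(col y) -cxy => /lcoset_eqP ax /lcoset_eqP ay.
  rewrite [LHS]surjective_pairing [RHS]surjective_pairing xE yE.
  by rewrite -/(col x) -/(col y) -cxy -ax -ay.
have [a aP] : exists a, forall x, a \in coset_at ends s col g x.
  apply: (@common_point _ _ _ _ _ _ sA _ col g _ _ k) => //.
  - by rewrite card_sig max_card.
  - move=> x y xy /existsP[a]; rewrite !cosE => /andP[ax ay].
    by apply: contraNneq xy => /(meet_eq _ _ a ax ay)->.
  - move=> x y /k_sparse/and3P[/existsP[a /andP[/andP[_ /eqP Ex] /andP[_ /eqP Ey]]] _ _].
    by apply/existsP; exists a; rewrite !cosE Ex Ey !lcoset_refl.
have aE (x : K) : in_cell (f (val x)) a.
  have := aP x; rewrite mem_lcoset => gaS.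
  by rewrite -(mulKVg (g x) a); apply: in_cell_mul (gP x).
have x0 : K.
  by have [K4 _] := K_conn; apply: (enum_val (A := K) (Ordinal (ltnW (ltnW (ltnW K4))))).
have aP0 : placed h u v (ty a) by case/andP: (aE x0) => /andP[].
pose role (x : R) := odflt x [pick r | ty a r == (f x).1].
have roleE x : x \in C -> ty a (role x) = (f x).1.
  move=> xC; have /andP[/andP[_ /existsP[r rE]] _] :=
    aE (exist (fun x => is_true (x \in C)) x xC).
  by rewrite /role; case: pickP => [r' /eqP//|/(_ r)]; rewrite rE.
have fE' x : x \in C -> f x = cell_vertex a (role x).
  move=> xC; have /andP[_ /eqP/= Ex] := aE (exist (fun x => is_true (x \in C)) x xC).
  by rewrite /cell_vertex roleE // [LHS]surjective_pairing Ex.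
apply: (C_copy (k := role)).
  by move=> x y xC yC Exy; apply: f_inj; rewrite !fE' // Exy.
move=> x y xC yC; have [<-|xy] := eqVneq x y; first by rewrite /twist !eqxx.
have rxy : role x != role y.
  by apply: contraNneq xy => Exy; apply/eqP/f_inj; rewrite !fE' // Exy.
by rewrite -sE // !fE' // cell_sparse // /twist rxy.
Qed.

End Host.

(** * Translation to embeddings and vertex sets *)

Lemma contains_inducedP (G H : sgraph) : contains_induced G H <->
  exists2 f : H -> G, injective f & forall x y, adj (f x) (f y) = adj x y.
Proof.
split=> [[A [f [g fK gK] fE]]|[f f_inj fE]].
  exists (fun x => val (g x)) => [|x y].
    by move=> x y /val_inj/(can_inj gK).
  by rewrite -[in RHS](gK x) -[in RHS](gK y) fE.
exists (f @: [set: H]).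
have inA x : f x \in f @: [set: H] by rewrite imset_f.
pose g x : induced (f @: [set: H]) :=
  exist (fun z => is_true (z \in f @: [set: H])) (f x) (inA x).
have gE (z : induced (f @: [set: H])) : exists x, g x == z.
  have /imsetP[x _ Ex] := valP z; exists x.
  by apply/eqP/val_inj; rewrite /= -Ex.
pose k z := xchoose (gE z).
have kK z : g (k z) = z by apply/eqP/(xchooseP (gE z)).
have gK x : k (g x) = x by apply: f_inj; apply: (congr1 val (kK (g x))).
exists k; first by exists g.
by move=> x y; rewrite -fE -[in RHS](kK x) -[in RHS](kK y).
Qed.

Lemma core_of_induced (G : sgraph) (r : rel G) : r =2 @adj G ->
  has_noncomplete_3connected_induced G -> exists C : {set G},
    [&& 4 < #|C|, set_conn3 r C & noncomplete_on r C].
Proof.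
move=> rE [S [S5 [_ Sc] Sn]]; exists S.
have cS : #|induced S| = #|S| by rewrite card_sig.
apply/and3P; split; first by rewrite -cS.
  apply/set_conn3P; split; first by rewrite -cS ltnW.
  move=> A A2 x y xA yA; pose X := [set z : induced S | val z \in A].
  have X2 : #|X| <= 2.
    apply: leq_trans A2; rewrite -(card_imset X val_inj); apply: subset_leq_card.
    by apply/subsetP=> _ /imsetP[z zX ->]; move: zX; rewrite inE.
  have inX z : z \in S :\: A -> exists z' : induced (~: X), val (val z') = z.
    rewrite inE => /andP[zA zS].
    pose z1 : induced S := exist (fun x => is_true (x \in S)) z zS.
    have z1X : z1 \in ~: X by rewrite !inE.
    by exists (exist (fun x => is_true (x \in ~: X)) z1 z1X).
  have [[x' <-] [y' <-]] := (inX _ xA, inX _ yA).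
  have memS (a : induced (~: X)) : val (val a) \in S :\: A.
    by have := valP a; rewrite !inE => ->; rewrite (valP (val a)).
  apply: (@connect_homo _ _ _ _ (fun z => val (val z))) (Sc X X2 x' y') => a c ac.
  by apply/and3P; rewrite rE !memS; split=> //; exact: ac.
have : [exists x : induced S, exists y : induced S, (x != y) && ~~ adj x y].
  apply: contraT => Hn; case: Sn => x y xy; apply: contraR Hn => nxy.
  by apply/existsP; exists x; apply/existsP; exists y; rewrite xy.
case/existsP=> x /existsP[y /andP[xy nxy]].
apply/exists_inP; exists (val x); first exact: valP.
apply/exists_inP; exists (val y); first exact: valP.
by rewrite (inj_eq val_inj) xy rE.
Qed.

Section Greedy.
Variables (H : sgraph) (X : finType) (c0 F : rel X).
Hypothesis c0_sym : symmetric c0.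
Hypothesis c0_irr : irreflexive c0.
Hypothesis F_sym : symmetric F.
Hypothesis F_c0 : forall x y, F x y -> c0 x y.
Hypothesis F_ex : exists x y, F x y.
Hypothesis c0_free : forall f : H -> X, injective f ->
  ~ (forall x y, c0 (f x) (f y) = adj x y).
Hypothesis F_del : forall (c : rel X) x y,
    (forall x y, F x y -> c x y) -> (forall x y, c x y -> c0 x y) -> F x y ->
  exists2 f : H -> X, injective f & forall z w,
    c (f z) (f w) && ([set f z; f w] != [set x; y]) = adj z w.

Definition between (D : {set X * X}) : bool :=
  [&& [forall x, forall y, ((x, y) \in D) == ((y, x) \in D)],
      [forall x, forall y, F x y ==> ((x, y) \in D)],
      [forall x, forall y, ((x, y) \in D) ==> c0 x y]
    & ~~ [exists f : {ffun H -> X}, injectiveb f &&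
          [forall x, forall y, ((f x, f y) \in D) == adj x y]]].

Lemma betweenP (D : {set X * X}) : reflect [/\ forall x y, ((x, y) \in D) = ((y, x) \in D),
    forall x y, F x y -> (x, y) \in D,
    forall x y, (x, y) \in D -> c0 x y
  & forall f : H -> X, injective f ->
      ~ (forall x y, ((f x, f y) \in D) = adj x y)] (between D).
Proof.
apply: (iffP and4P) => -[D1 D2 D3 D4]; split.
- by move=> x y; apply/eqP; move/forallP/(_ x)/forallP/(_ y): D1.
- by move=> x y; move/forallP/(_ x)/forallP/(_ y)/implyP: D2.
- by move=> x y; move/forallP/(_ x)/forallP/(_ y)/implyP: D3.
- move=> f f_inj fE; case/negP: D4; apply/existsP; exists (finfun f).
  apply/andP; split; first by apply/injectiveP=> x y; rewrite !ffunE; apply: f_inj.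
  by apply/forallP=> x; apply/forallP=> y; rewrite !ffunE fE.
- by apply/forallP=> x; apply/forallP=> y; rewrite D1.
- by apply/forallP=> x; apply/forallP=> y; apply/implyP/D2.
- by apply/forallP=> x; apply/forallP=> y; apply/implyP/D3.
apply/existsP=> -[f /andP[/injectiveP f_inj /forallP fE]].
by apply: (D4 f f_inj) => x y; apply/eqP; move/forallP: (fE x).
Qed.

(** Take a smallest [H]-free edge set between [F] and [c0]. Deleting an edge of [F] creates [H] by
    [F_del]; deleting any other edge does so by minimality. *)
Lemma greedy_host : exists G : sgraph, deletion_host H G.
Proof.
have D0P : between [set p | c0 p.1 p.2].
  apply/betweenP; split.
  - by move=> x y; rewrite !inE c0_sym.
  - by move=> x y Fxy; rewrite inE F_c0.
  - by move=> x y; rewrite inE.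
  by move=> f f_inj fE; apply: (c0_free f_inj) => x y; rewrite -fE inE.
case: (arg_minnP (fun D : {set X * X} => #|D|) D0P) => D /betweenP[D1 D2 D3 D4] Dmin.
have D_sym : symmetric (fun x y => (x, y) \in D) by move=> x y; apply: D1.
have D_irr : irreflexive (fun x y => (x, y) \in D).
  by move=> x; apply: contraNF (negbT (c0_irr x)) => /D3.
pose G := SGraph D_sym D_irr.
exists G; split.
- have [x [y Fxy]] := F_ex; apply/set0Pn; exists [set x; y].
  by apply/imsetP; exists (x, y); rewrite // inE; apply: D2.
- by case/contains_inducedP => f f_inj; apply: D4.
move=> _ /imsetP[[x y] + ->]; rewrite inE /= => xyD; apply/contains_inducedP.
have [Fxy|Fxy] := boolP (F x y).
  exact: (@F_del (fun x y => (x, y) \in D)).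
pose D' := [set p in D | [set p.1; p.2] != [set x; y]].
have D'D : #|D'| < #|D|.
  apply: proper_card; apply/properP; split; first by apply/subsetP=> p; rewrite inE => /andP[].
  by exists (x, y) => //; rewrite !inE eqxx andbF.
have : ~~ between D'.
  by apply/negP => /Dmin; rewrite leqNgt D'D.
have [/existsP[f /andP[/injectiveP f_inj /forallP fE]] _|f0] :=
    boolP [exists f : {ffun H -> X}, injectiveb f &&
      [forall x, forall y, ((f x, f y) \in D') == adj x y]].
  exists f => // z w; move/forallP/(_ w)/eqP: (fE z) => <-.
  by rewrite inE.
rewrite /between f0 andbT => /negP[]; apply/and3P; split.
- by apply/forallP=> z; apply/forallP=> w; rewrite !inE /= D1 setUC.
- apply/forallP=> z; apply/forallP=> w; apply/implyP=> Fzw.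
  rewrite inE D2 //=; apply: contra Fxy; rewrite eq_set2.
  by case/orP=> /andP[/eqP <- /eqP <-] //; rewrite F_sym.
by apply/forallP=> z; apply/forallP=> w; apply/implyP; rewrite inE => /andP[/D3].
Qed.
End Greedy.

Theorem corollary5p3 (H : sgraph)
  (hH : has_noncomplete_3connected_induced H \/
        has_noncomplete_3connected_induced (compl H)) :
  exists G : sgraph, deletion_host H G.
Proof.
have [b0 [C0 bC0]] : exists b0 C0, core (@adj H) (b0, C0).
  case: hH => [/(core_of_induced (r := twist (@adj H) false))|
               /(core_of_induced (G := compl H) (r := twist (@adj H) true))].
    case=> [x y|C]; last by exists false, C.
    by rewrite /twist addbF; case: eqP => // ->; rewrite adj_irrefl.
  case=> [x y|C]; last by exists true, C.
  by rewrite /twist addbT.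
have [b [C [u [v [[bC uC vC uv huv] max]]]]] := core_exists bC0.
have Ccopy := no_copy (@adj_sym H) bC uC vC uv huv max.
(* The closed walks to be controlled run through vertices of one copy of [H], so [#|H|] bounds their
   length. *)
have [gT [s [pi [piM pi_s sA]]]] :=
  acyclic_group_exists (@ends2 _) (@swap _ (@adj H) u v) #|H|.
(* The identity cell needs some placement; the bits of these two colours disagree, so they are
   adjacent and [place] applies. *)
have [p0 [p0P _ _]] : exists p : {ffun H -> color H}, [/\ placed (@adj H) u v p,
    p u = (u, [ffun=> true]) & p v = (v, [ffun=> false])].
  by apply: place => //; [apply: adj_sym | rewrite /cadj /= uv !ffunE].
have /and3P[_ Cc _] := bC.
pose c0 := twist (sparse (@adj H) u v b s pi p0) b.
pose F := fixed_edge (@adj H) u v s pi p0.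
apply: (@greedy_host H _ c0 F).
- exact/twist_sym/sparse_sym.
- by move=> x; rewrite /c0 /twist eqxx.
- exact: fixed_sym.
- by move=> x y; apply: fixed_sub.
- exact: (fixed_exists uv s piM p0P).
- move=> f; apply: (sparse_free (@adj_sym H) uv Cc _ piM pi_s sA) => k k_inj.
  exact: Ccopy.
by move=> c x y; apply: (fixed_delete (@adj_sym H) (@adj_irrefl H) uv huv piM pi_s).
Qed.
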